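(* For every $\alpha\in(0,1)$ and every $\beta\ge\max(\alpha,1-\alpha)$, the function $x\mapsto D_{\alpha,\beta}(x^{1/\alpha})$ is completely monotonic on $(0,+\infty)$, where $D_{\alpha,\beta}(x)=\mathcal{L}_\beta F_{\alpha,\beta}(x)-F_{\alpha,\beta}(x)$ for $x>0$.
   Context: A smooth function $f$ on $(0,+\infty)$ is completely monotonic (CM) if $(-1)^n f^{(n)}(x)\ge 0$ for all $n\ge 0$ and $x>0$ (in particular the zero function is CM). For $\alpha,\beta>0$ the generalized Mittag-Leffler function is the entire function $E_{\alpha,\beta}(z)=\sum_{n\ge 0}\frac{z^n}{\Gamma(\beta+\alpha n)}$, $z\in\mathbb{C}$. Set $F_{\alpha,\beta}(x)=E_{\alpha,\beta}(x^\alpha)$ for $x>0$, with $F_{\alpha,\beta}(0)=1/\Gamma(\beta)$. For $\beta>0$ the differential-difference operator $\mathcal{L}_\beta$ is $\mathcal{L}_\beta f(x)=f'(x)+\frac{\beta-1}{x}\,(f(x)-f(0))$. One has, for $x>0$, the convergent series representation $$D_{\alpha,\beta}(x)=\sum_{n\ge 1}\frac{x^{\alpha n-1}}{\Gamma(\beta+\alpha n-1)}-\sum_{n\ge 0}\frac{x^{\alpha n}}{\Gamma(\beta+\alpha n)},$$ with the usual convention $1/\Gamma=0$ at the poles of $\Gamma$. *)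

(* Defs.v *)
From HB Require Import structures.
From mathcomp Require Import all_boot all_order all_algebra.
From mathcomp Require Import all_classical all_reals all_analysis.
Set Implicit Arguments.
Unset Strict Implicit.
Unset Printing Implicit Defensive.
Import Order.TTheory GRing.Theory Num.Theory.
Import numFieldNormedType.Exports.
Local Open Scope classical_set_scope.
Local Open Scope ring_scope.

(* Behaviour at x <= 0 is irrelevant: derivatives at x > 0 are local and
   ]0, +oo[ is open, so f may be any total extension. *)
Definition completely_monotonic (R : realType) (f : R -> R) : Prop :=
  forall (n : nat) (x : R), 0 < x ->
    derivable (derive1n n f) x 1 /\ 0 <= (-1) ^+ n * derive1n n f x.

(* Euler's integral: the Gamma function on x > 0 only. For x <= 0 the integral
   diverges and the value is the meaningless fine +oo = 0. *)
Definition Gamma (R : realType) (x : R) : R :=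
  \int[@lebesgue_measure R]_(t in `]0, +oo[) (t `^ (x - 1) * expR (- t)).

(* E_{alpha,beta} on the real line. For alpha, beta > 0 Gamma is only used at
   the positive points beta + alpha n and the series converges everywhere. *)
Definition mittag_leffler (R : realType) (alpha beta z : R) : R :=
  limn (pseries (fun n => (Gamma (beta + alpha * n%:R))^-1) z).

Definition ML_pow (R : realType) (alpha beta x : R) : R :=
  mittag_leffler alpha beta (x `^ alpha).

(* 0 `^ alpha = 0 for alpha != 0, so the total ML_pow takes the expected value
   at the origin. *)
Lemma ML_pow0 (R : realType) (alpha beta : R) :
  alpha != 0 -> ML_pow alpha beta 0 = (Gamma beta)^-1.
Proof.
move=> alpha0; rewrite /ML_pow powR0// /mittag_leffler.
apply: cvg_lim => //; rewrite -(cvg_shiftS _); apply: cvg_near_cst.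
apply: nearW => n; rewrite /pseries /series /= big_nat_recl//.
rewrite mulr0 addr0 expr0 mulr1 big1 ?addr0// => i _.
by rewrite expr0n mulr0.
Qed.

Definition Lop (R : realType) (beta : R) (f : R -> R) (x : R) : R :=
  derive1 f x + (beta - 1) / x * (f x - f 0).

Definition Dfun (R : realType) (alpha beta x : R) : R :=
  Lop beta (ML_pow alpha beta) x - ML_pow alpha beta x.

(* Main.v *)
Require Import Defs.
From HB Require Import structures.
From mathcomp Require Import all_boot all_order all_algebra.
From mathcomp Require Import all_classical all_reals all_analysis measurable_realfun.
From mathcomp Require Import ring lra.
Import Order.TTheory GRing.Theory Num.Theory.
Import numFieldNormedType.Exports.
Local Open Scope classical_set_scope.
Local Open Scope ring_scope.

Set Implicit Arguments.
Unset Strict Implicit.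
Unset Printing Implicit Defensive.

(** Write [E b t] for the sum of [t ^ n / Gamma (b + alpha n)].  Differentiating
the Mittag-Leffler series term by term gives

  [D (t ^ (1 / alpha))
     = sum_(n >= 1) t ^ (n - 1 / alpha) / Gamma (beta + alpha n - 1) - E beta t],

where a term containing [Gamma 0], possible for [n = 1] only, is read as [0].
Write [1 / alpha - 1 = m + q] with [m] a natural number and [0 <= q < 1].  The
first [m] terms of the first sum are nonnegative multiples of negative powers
of [t] (this uses [beta >= 1 - alpha]), and its other terms add up to
[t ^ (- q) * E (beta - alpha q) t].  Negative powers are completely monotonic,
so everything rests on the complete monotonicity, for [beta >= alpha], of the gap

  [t ^ (- q) * E (beta - alpha q) t - E beta t]        (lemma [diff_mono_ML_gap]).

Let [c_N (g) = g (g + 1) ... (g + N - 1) / N!].  By Gauss's formula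
[1 / Gamma (g)] is the limit of [N ^ (1 - g) c_N (g)], so the gap is the limit,
when [N] grows and [x = t N ^ (- alpha)], of [N ^ (1 - beta)] times

  [sum_n x ^ (n - q) c_N (beta + alpha (n - q)) - sum_n x ^ n c_N (beta + alpha n)].

The exchange of limits is Tannery's theorem: [N ^ (1 - g) c_N (g)] decreases
with [N] when [g >= 1], so the terms of one fixed large index dominate.

When [0 <= alpha <= min (1, beta)], a recurrence on [N] gives nonnegative numbers
[A_k] with [c_N (beta + alpha s) = sum_(k <= N) A_k c_k (s + 1)] for all real
[s] (lemma [rbinom_affine_expansion]).  It is therefore enough to treat

  [x ^ (- q) * sum_n c_k (n + 1 - q) x ^ n - sum_n c_k (n + 1) x ^ n]

on [(0, 1)].  If [1 - (1 - y) ^ q] is the sum of the [b_j y ^ j], with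
[b_j >= 0], this difference is [x ^ (- q)] times the sum over [j > k] of
[b_j (1 - x) ^ (j - k - 1)] (lemma [kernelE]), a product of two power series in
[1 - x] with nonnegative coefficients.

Complete monotonicity is expressed throughout by signs of iterated finite
differences (predicate [diff_mono]), a property that passes to pointwise limits,
sums and products; for a smooth function on [(0, +oo)] it gives back the signs
of the derivatives (lemma [diff_mono_completely_monotonic]). *)

(** * Gauss's formula for the Gamma function *)

(** The integrand may be unbounded at the origin, so the integral is the limit of
the integrals over [[L / (i + 2), L]]. *)
Lemma integral_powR (R : realType) (g L : R) : 0 < g -> 0 < L ->
  (\int[@lebesgue_measure R]_(t in `]0%R, L]%classic) (t `^ (g - 1))%:E
   = (L `^ g / g)%:E)%E.
Proof.
move=> g0 L0.
pose F (i : nat) : set R := `[L / i.+2%:R, L]%classic.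
have e0 i : 0 < L / i.+2%:R by rewrite divr_gt0.
have FU : (\bigcup_i F i)%classic = `]0%R, L]%classic.
  apply/seteqP; split => x /=.
    by move=> [i _]; rewrite /F /= !in_itv/= => /andP[/(lt_le_trans (e0 i)) -> ->].
  rewrite in_itv/= => /andP[x0 xL]; exists (Num.trunc (L / x)) => //.
  rewrite /F /= in_itv/= xL andbT ler_pdivrMr//.
  rewrite -ler_pdivrMl// mulrC.
  have /andP[_ /ltW h] : ((Num.trunc (L / x))%:R <= L / x < (Num.trunc (L / x)).+1%:R).
    by apply: truncn_itv; rewrite divr_ge0// ltW.
  by apply: le_trans h _; rewrite ler_nat.
have FE i : (\int[@lebesgue_measure R]_(t in F i) (t `^ (g - 1))%:E
   = (g^-1 * L `^ g)%:E - (g^-1 * (L / i.+2%:R) `^ g)%:E)%E.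
  have der (x : R) : 0 < x -> is_derive x (1 : R) (fun y : R => g^-1 * y `^ g) (x `^ (g - 1)).
    move=> x0; have := @is_derive1_powR R g x x0.
    move=> /(@is_deriveZ R R R (@powR R ^~ g) g^-1 x 1 _).
    by rewrite /GRing.scale /= mulKf// gt_eqF.
  have cts (x : R) : 0 < x -> {for x, continuous (fun y : R => g^-1 * y `^ g)}.
    move=> x0; apply: differentiable_continuous; apply/derivable1_diffP.
    by have [] := der x x0.
  rewrite (@continuous_FTC2 _ _ (fun y : R => g^-1 * y `^ g))//.
  - by rewrite ltr_pdivrMr// -[X in X < _]mulr1 ltr_pM2l// ltr1n.
  - apply: derivable_within_continuous => x.
    rewrite in_itv/= => /andP[/(lt_le_trans (e0 i)) x0 _].
    by have [] := @is_derive1_powR R (g-1) x x0.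
  - split.
    + move=> x; rewrite in_itv/= => /andP[/(lt_trans (e0 i)) x0 _].
      by have [] := der x x0.
    + apply: cvg_at_right_filter; exact: cts (e0 i).
    + apply: cvg_at_left_filter; exact: cts L0.
  - move=> x; rewrite in_itv/= => /andP[/(lt_trans (e0 i)) x0 _].
    by rewrite derive1E; have [_ ->] := der x x0.
have mpow (D : set R) : measurable_fun D (EFin \o (fun t : R => t `^ (g - 1))).
  apply/measurable_EFinP; apply: measurable_funTS; exact: measurable_powR.
have := @ge0_nondecreasing_set_cvg_integral _ (measurableTypeR R) R F
  (fun t : R => (t `^ (g - 1))%:E) (@lebesgue_measure R).
have ndF : nondecreasing_seq F.
  apply/nondecreasing_seqP => i; apply/subsetPset => x.
  rewrite /F /= !in_itv/= => /andP[h ->]; rewrite andbT.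
  by apply: le_trans h; rewrite ler_pM2l// lef_pV2 ?posrE// ler_nat.
rewrite FU => /(_ ndF (fun i => measurable_itv _) (fun i => mpow _)) H.
have {H}/cvg_lim <- // := H (fun i x _ => powR_ge0 x _).
apply/cvg_lim => //.
under eq_fun do rewrite FE.
apply: (@cvg_trans _ ((g^-1 * L `^ g - g^-1 * (L / i.+2%:R) `^ g)%:E @[i --> \oo])).
  by under eq_fun do rewrite -EFinB.
apply: cvg_EFin; first exact: nearW.
rewrite /=.
rewrite [X in _ --> X](_ : _ = g^-1 * L `^ g - g^-1 * 0); last by ring.
apply: cvgB; first exact: cvg_cst.
apply: cvgM; first exact: cvg_cst.
have /cvg_at_rightP := powR_cvg0 g0; apply; split => //.
rewrite -(mulr0 L); apply: cvgM; first exact: cvg_cst.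
have := @cvg_harmonic R; by rewrite -cvg_shiftS.
Qed.

(** Induction on [m] for all [g] at once, from
[t ^ (g - 1) (1 - t / L) ^ m.+1 + t ^ g (1 - t / L) ^ m / L = t ^ (g - 1) (1 - t / L) ^ m]. *)
Lemma euler_beta_integral (R : realType) (m : nat) (g L : R) : 0 < g -> 0 < L ->
  (\int[@lebesgue_measure R]_(t in `]0%R, L]) (t `^ (g - 1) * (1 - t / L) ^+ m)%:E
   = (L `^ g * m`!%:R / \prod_(i < m.+1) (g + i%:R))%:E)%E.
Proof.
move=> g0 L0; elim: m g g0 => [|m IH] g g0.
  rewrite big_ord1 addr0 fact0 mulr1 -integral_powR//.
  by apply: eq_integral => t _; rewrite expr0 mulr1.
have mf (a : R) k : measurable_fun `]0%R, L] (EFin \o (fun t : R => t `^ a * (1 - t / L) ^+ k)).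
  apply/measurable_EFinP; apply: measurable_funM.
    by apply: measurable_funTS; exact: measurable_powR.
  apply: measurable_funX; apply: measurable_funB => //.
  exact: measurable_funM.
have f0 (a : R) k (t : R) : (`]0%R, L]%classic : set R) t -> 0 <= t `^ a * (1 - t / L) ^+ k.
  rewrite /= in_itv/= => /andP[t0 tL]; rewrite mulr_ge0 ?powR_ge0// exprn_ge0//.
  by rewrite subr_ge0 ler_pdivrMr// mul1r.
have g10 : 0 < g + 1 by lra.
have H1 := IH _ g0; have H2 := IH _ g10.
have : ((L^-1)%:E *
     \int[@lebesgue_measure R]_(t in `]0%R, L]) (t `^ (g + 1 - 1) * (1 - t / L) ^+ m)%:E
   + \int[@lebesgue_measure R]_(t in `]0%R, L]) (t `^ (g - 1) * (1 - t / L) ^+ m.+1)%:E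
  = \int[@lebesgue_measure R]_(t in `]0%R, L]) (t `^ (g - 1) * (1 - t / L) ^+ m)%:E)%E.
  rewrite -ge0_integralZl_EFin//; last 3 first.
    - by move=> t /f0; rewrite lee_fin; apply.
    - exact: mf.
    - by rewrite invr_ge0 ltW.
  rewrite -ge0_integralD//; last 4 first.
    - by move=> t Dt; apply: mule_ge0; rewrite lee_fin ?invr_ge0 ?(ltW L0)//; exact: f0 Dt.
    - apply: (@measurable_funeM _ (measurableTypeR R)); exact: mf.
    - by move=> t /f0; rewrite lee_fin; apply.
    - exact: mf.
  apply: eq_integral => t; rewrite inE /= in_itv/= => /andP[t0 tL].
  rewrite -EFinM -EFinD; congr (_%:E).
  have -> : g + 1 - 1 = (g - 1) + 1 by ring.
  rewrite powRD; last by rewrite (gt_eqF t0) implybT.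
  by rewrite powRr1 ?ltW// exprS; field; rewrite gt_eqF.
rewrite H1 H2 -EFinM.
set X := (\int[_]_(x in _) _)%E; case: X => [x| |] //.
rewrite -EFinD => -[E]; congr (_%:E).
have {E} -> : x = L `^ g * m`!%:R / \prod_(i < m.+1) (g + i%:R) -
   L^-1 * (L `^ (g + 1) * m`!%:R / \prod_(i < m.+1) (g + 1 + i%:R)) by rewrite -E; ring.
rewrite powRD; last by rewrite (gt_eqF L0) implybT.
rewrite powRr1 ?ltW// factS natrM.
rewrite [\prod_(i < m.+1) (g + 1 + i%:R)]big_ord_recr/=.
rewrite [\prod_(i < m.+2) _]big_ord_recr/= !big_ord_recl/=.
have -> : \prod_(i < m) (g + 1 + i%:R) = \prod_(i < m) (g + (bump 0 i)%:R) :> R.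
  by apply: eq_bigr => i _; rewrite /bump/= natrD; ring.
have p0 : \prod_(i < m) (g + (bump 0 i)%:R) != 0 :> R.
  by rewrite gt_eqF// prodr_gt0// => i _; rewrite ltr_pwDl.
rewrite addr0 -natr1; have m0 := ler0n R m; field.
by rewrite p0 !gt_eqF//; lra.
Qed.

(** The integrand is at most [t ^ (g - 1)] on [(0, 1]], and a multiple of the
exponential density [exp (- t / 2) / 2] beyond [1]. *)
Lemma integrable_gamma (R : realType) (g : R) : 0 < g ->
  (@lebesgue_measure R).-integrable `]0%R, +oo[
     (EFin \o (fun t : R => t `^ (g - 1) * expR (- t))).
Proof.
move=> g0.
pose k := (Num.trunc `|g|).+1.
have gk : g - 1 <= k%:R.
  have /andP[_ /ltW h] : (Num.trunc `|g|)%:R <= `|g| < k%:R by exact: truncn_itv.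
  by apply: le_trans h; have := ler_norm g; lra.
pose C : R := 2 * (2 ^+ k * k`!%:R).
have C0 : 0 <= C by rewrite /C !mulr_ge0// exprn_ge0.
pose h1 : R -> \bar R := (EFin \o (fun t : R => t `^ (g - 1))) \_ `]0%R, 1%R].
pose h2 : R -> \bar R := (fun t => C%:E * (exponential_pdf (2^-1 : R) t)%:E)%E.
have mp (D : set R) : measurable_fun D (EFin \o (fun t : R => t `^ (g - 1))).
  by apply/measurable_EFinP; apply: measurable_funTS; exact: measurable_powR.
have i1 : (@lebesgue_measure R).-integrable `]0%R, 1%R] (EFin \o (fun t : R => t `^ (g - 1))).
  apply/integrableP; split; first exact: mp.
  rewrite (_ : integral _ _ _ = (1 `^ g / g)%:E) ?ltry//.
  rewrite -integral_powR//; apply: eq_integral => t _.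
  by rewrite /= ger0_norm// powR_ge0.
have ih : (@lebesgue_measure R).-integrable `]0%R, +oo[ (h1 \+ h2)%E.
  apply: (@integrableS _ (measurableTypeR R) R _ setT) => //.
  apply: integrableD => //.
    by rewrite /h1 -integrable_mkcond.
  apply: integrableZl => //.
  exact: integrable_exponential_pdf.
have H (t : R) : 1 < t -> t `^ (g - 1) <= 2 ^+ k * k`!%:R * expR (t / 2).
  move=> t1; have t0 : 0 < t by lra.
  apply: (@le_trans _ _ (t `^ k%:R)); first by apply: ler_powR => //; rewrite ltW.
  rewrite powR_mulrn ?(ltW t0)//.
  have := @expR_ge1Dxn R (t / 2) (Num.trunc `|g|); rewrite -/k.
  rewrite expr_div_n => H'.
  have t20 : 0 <= t / 2 :> R by rewrite divr_ge0// ltW.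
  have : t ^+ k / 2 ^+ k / k`!%:R <= expR (t / 2) by apply: le_trans (H' t20); rewrite lerDr.
  rewrite ler_pdivrMr ?ltr0n ?fact_gt0// ler_pdivrMr ?exprn_gt0//.
  move=> h; apply: le_trans h _; rewrite le_eqVlt; apply/orP; left; apply/eqP; ring.
apply: le_integrable ih => //.
  apply/measurable_EFinP; apply: measurable_funM.
    by apply: measurable_funTS; exact: measurable_powR.
  apply: measurable_funTS; apply: measurableT_comp => //; exact: measurable_oppr.
move=> t; rewrite /= in_itv/= andbT => t0.
have p0 : 0 <= exponential_pdf (2^-1 : R) t by apply: exponential_pdf_ge0.
rewrite ger0_norm ?mulr_ge0 ?powR_ge0 ?expR_ge0//.
apply: (le_trans _ (lee_abs _)).
rewrite /h1 /h2 patchE; case: ifPn => [|/negP].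
  rewrite inE/= in_itv/= => /andP[_ t1].
  rewrite -EFinM -EFinD lee_fin ler_wpDr//; first exact: mulr_ge0.
  by rewrite ler_piMr ?powR_ge0// -expR0 ler_expR oppr_le0 ltW.
rewrite inE/= in_itv/= t0/= => /negP; rewrite -ltNge => t1.
rewrite add0e -EFinM lee_fin exponential_pdfE ?(ltW t0)//.
apply: le_trans (ler_wpM2r (expR_ge0 _) (H t t1)) _.
have -> : - 2^-1 * t = t / 2 + - (t : R) :> R by lra.
rewrite expRD /C le_eqVlt; apply/orP; left; apply/eqP.
by field.
Qed.

(** Bernoulli's inequality. *)
Lemma bernoulli_onem (R : realDomainType) (x : R) (n : nat) : 0 <= x <= 1 ->
  1 - n%:R * x <= (1 - x) ^+ n.
Proof.
move=> /andP[x0 x1]; elim: n => [|n IH]; first by rewrite expr0 mul0r subr0.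
rewrite exprS -natr1; apply: le_trans (ler_wpM2l _ IH); last by rewrite subr_ge0.
have : 0 <= n%:R * x * x by rewrite !mulr_ge0.
by lra.
Qed.

Lemma onem_le_expR (R : realType) (x : R) (n : nat) : x <= 1 ->
  (1 - x) ^+ n <= expR (- (n%:R * x)).
Proof.
move=> x1; rewrite -mulrN expRM_natl; apply: lerXn2r.
- by rewrite nnegrE subr_ge0.
- by rewrite nnegrE expR_ge0.
- exact: expR_ge1Dx.
Qed.

Lemma cvg_divr_succn (R : realType) (a : R) : (a / n.+1%:R) @[n --> \oo] --> (0 : R).
Proof.
rewrite -[X in _ --> X](mulr0 a); apply: cvgM; first exact: cvg_cst.
exact: cvg_harmonic.
Qed.

(** Squeeze: with [x = t / N], from [(1 - x) exp x >= 1 - x ^ 2] and Bernoulli,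
[exp (- t) (1 - t ^ 2 / N) <= (1 - t / N) ^ N <= exp (- t)]. *)
Lemma cvg_onem_expR (R : realType) (t : R) : 0 < t ->
  (1 - t / n.+1%:R) ^+ n.+1 @[n --> \oo] --> expR (- t).
Proof.
move=> t0.
have tn : \forall n \near \oo, t / n.+1%:R <= 1.
  have /cvgr_lt /(_ _ (@ltr01 R)) := cvg_divr_succn t.
  by apply: filterS => n /ltW.
have c1 : (fun n : nat => expR (- t) * (1 - t ^+ 2 / n.+1%:R)) n @[n --> \oo] --> expR (- t).
  rewrite -[X in _ --> X]mulr1; apply: cvgM; first exact: cvg_cst.
  rewrite -[X in _ --> X]subr0; apply: cvgB; first exact: cvg_cst.
  exact: cvg_divr_succn.
apply: (squeeze_cvgr _ c1 (@cvg_cst _ _ _ _ _)).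
near=> n.
have xn : t / n.+1%:R <= 1 by near: n.
have x0 : 0 <= t / n.+1%:R by rewrite divr_ge0// ltW.
have E : n.+1%:R * (t / n.+1%:R) = t by rewrite mulrC divfK.
apply/andP; split; last by have := onem_le_expR n.+1 xn; rewrite E.
set x := t / n.+1%:R in xn x0 E *.
have x2 : 0 <= x ^+ 2 <= 1 by rewrite exprn_ge0// exprn_ile1.
have H1 := bernoulli_onem n.+1 x2.
have -> : t ^+ 2 / n.+1%:R = n.+1%:R * x ^+ 2.
  by rewrite /x expr_div_n; field.
rewrite expRN mulrC ler_pdivrMr ?expR_gt0//; apply: le_trans H1 _.
have -> : 1 - x ^+ 2 = (1 - x) * (1 + x) by ring.
rewrite exprMn ler_wpM2l ?exprn_ge0 ?subr_ge0//.
rewrite -[X in expR X]E expRM_natl lerXn2r ?nnegrE ?expR_ge0 ?addr_ge0//.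
exact: expR_ge1Dx.
Unshelve. all: by end_near. Qed.

(** Gauss's product formula, by dominated convergence in the integral of
[t ^ (g - 1) (1 - t / N) ^ N] over [(0, N]]; the index is [N = n.+1]. *)
Lemma cvg_Gamma_gauss (R : realType) (g : R) : 0 < g ->
  n.+1%:R `^ g * n.+1`!%:R / \prod_(i < n.+2) (g + i%:R) @[n --> \oo]
    --> Gamma g.
Proof.
move=> g0.
pose D : set R := `]0%R, +oo[%classic.
pose A (n : nat) : set R := `]0%R, n.+1%:R]%classic.
pose u (n : nat) (t : R) := t `^ (g - 1) * (1 - t / n.+1%:R) ^+ n.+1.
pose f_ (n : nat) : R -> \bar R := (EFin \o u n) \_ (A n).
pose f : R -> \bar R := EFin \o (fun t : R => t `^ (g - 1) * expR (- t)).
have mA n : measurable (A n) by exact: measurable_itv.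
have mu_ n (E : set R) : measurable_fun E (EFin \o u n).
  apply/measurable_EFinP; apply: measurable_funM.
    by apply: measurable_funTS; exact: measurable_powR.
  apply: measurable_funX; apply: measurable_funB => //.
  exact: measurable_funM.
have If := integrable_gamma g0.
have DA n : D `&` A n = A n.
  apply/seteqP; split => x /=; first by move=> [].
  by rewrite /D /A /= !in_itv/= andbT => /andP[-> ->].
have cf (x : R) : D x -> f_ ^~ x @ \oo --> f x.
  rewrite /D /= in_itv/= andbT => x0.
  apply: (@cvg_trans _ ((u n x)%:E @[n --> \oo])).
    apply: near_eq_cvg; near=> n; rewrite /f_ patchE ifT//.
    rewrite inE /A /= in_itv/= x0/=; near: n.
    have : (n%:R : R) @[n --> \oo] --> +oo by exact: cvgr_idn.
    move=> /cvgryPge /(_ x); apply: filterS => n /le_trans; apply.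
    by rewrite ler_nat.
  apply: cvg_EFin; first exact: nearW.
  apply: cvgM; first exact: cvg_cst.
  exact: cvg_onem_expR.
have bf n (x : R) : D x -> (`|f_ n x| <= f x)%E.
  rewrite /D /= in_itv/= andbT => x0.
  rewrite /f_ patchE; case: ifPn => [|_]; last first.
    by rewrite abse0 lee_fin mulr_ge0 ?powR_ge0 ?expR_ge0.
  rewrite inE /A /= in_itv/= x0/= => xn.
  have x1 : x / n.+1%:R <= 1 by rewrite ler_pdivrMr// mul1r.
  rewrite lee_fin ger0_norm; last by rewrite mulr_ge0 ?powR_ge0// exprn_ge0// subr_ge0.
  apply: ler_wpM2l; first exact: powR_ge0.
  have -> : x = n.+1%:R * (x / n.+1%:R) by rewrite mulrC divfK.
  by rewrite [X in 1 - X / _]mulrC mulfK//; exact: onem_le_expR.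
have := @dominated_cvg _ (measurableTypeR R) R (@lebesgue_measure R) D _ f_ f f
  _ cf _ If bf.
have mf_ n : measurable_fun D (f_ n : measurableTypeR R -> \bar R).
  apply: (iffLR (@measurable_restrict _ _ (measurableTypeR R) _ (A n) D
    (EFin \o u n) (mA n) (measurable_itv _))).
  exact: mu_.
move=> /(_ (measurable_itv _) mf_ (fun _ _ => isT)) H.
have E n : (\int[@lebesgue_measure R]_(x in D) f_ n x)%E =
   (n.+1%:R `^ g * n.+1`!%:R / \prod_(i < n.+2) (g + i%:R))%:E.
  rewrite /f_ -integral_mkcondr DA -euler_beta_integral//.
have fin : (\int[@lebesgue_measure R]_(x in D) f x)%E \is a fin_num.
  exact: (integrable_fin_num _ If).
have : fine (\int[@lebesgue_measure R]_(x in D) f_ n x)%E @[n --> \oo] --> Gamma g.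
  apply: fine_cvg; rewrite /Gamma /Rintegral fineK//.
apply: cvg_trans; apply: near_eq_cvg; apply: nearW => n.
by rewrite E.
Unshelve. all: by end_near. Qed.

(** The number [g (g + 1) ... (g + n - 1) / n!], that is the coefficient of [y ^ n]
in [(1 - y) ^ (- g)]. *)
Definition rbinom (R : realType) (n : nat) (g : R) : R :=
  \prod_(i < n) ((g + i%:R) / i.+1%:R).

Lemma rbinom0 (R : realType) (g : R) : rbinom 0 g = 1.
Proof. by rewrite /rbinom big_ord0. Qed.

Lemma rbinomS (R : realType) n (g : R) :
  rbinom n.+1 g = rbinom n g * ((g + n%:R) / n.+1%:R).
Proof. by rewrite /rbinom big_ord_recr. Qed.

Lemma rbinom_gt0 (R : realType) n (g : R) : 0 < g -> 0 < rbinom n g.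
Proof. by move=> g0; apply: prodr_gt0 => i _; rewrite divr_gt0// ltr_pwDl. Qed.

Lemma rbinom_ge0 (R : realType) n (g : R) : 0 <= g -> 0 <= rbinom n g.
Proof. by move=> g0; apply: prodr_ge0 => i _; rewrite divr_ge0// addr_ge0. Qed.

Lemma rbinomE (R : realType) n (g : R) :
  rbinom n g = (\prod_(i < n) (g + i%:R)) / n`!%:R.
Proof.
elim: n => [|n IH]; first by rewrite rbinom0 big_ord0 fact0 divr1.
by rewrite rbinomS IH big_ord_recr/= factS natrM mulf_div [n.+1%:R * _]mulrC.
Qed.

Lemma rbinom_shift (R : realType) n (g : R) :
  rbinom n g * (g + n%:R) = g * rbinom n (g + 1).
Proof.
elim: n => [|n IH]; first by rewrite !rbinom0 addr0 mulrC.
rewrite !rbinomS [g * _]mulrA -IH -natr1; field.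
by rewrite natr1 pnatr_eq0.
Qed.

Lemma rbinom_pascal (R : realType) n (g : R) :
  rbinom n.+1 (g + 1) = rbinom n.+1 g + rbinom n (g + 1).
Proof.
have E : rbinom n.+1 g = g * rbinom n (g + 1) / n.+1%:R.
  by rewrite rbinomS -rbinom_shift mulrA.
by rewrite E rbinomS -natr1; field; rewrite natr1 pnatr_eq0.
Qed.

(** Gauss's approximation [N ^ (1 - g) * rbinom N g] of [1 / Gamma g], at
[N = n.+1]. *)
Definition gauss (R : realType) (n : nat) (g : R) : R :=
  n.+1%:R `^ (1 - g) * rbinom n.+1 g.

Lemma gauss_gt0 (R : realType) n (g : R) : 0 < g -> 0 < gauss n g.
Proof. by move=> g0; rewrite mulr_gt0 ?powR_gt0// rbinom_gt0. Qed.

Lemma gauss_shift (R : realType) n (g : R) :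
  gauss n g * ((g + n.+1%:R) / n.+1%:R) = g * gauss n (g + 1).
Proof.
have n0 : n.+1%:R != 0 :> R by rewrite pnatr_eq0.
have -> : gauss n g * ((g + n.+1%:R) / n.+1%:R) =
    n.+1%:R `^ (1 - g) * (rbinom n.+1 g * (g + n.+1%:R)) / n.+1%:R.
  by rewrite /gauss !mulrA.
have -> : 1 - g = 1 - (g + 1) + 1 by ring.
rewrite rbinom_shift powRD; last by rewrite n0 implybT.
rewrite powRr1 /gauss//; field.
by rewrite addrC natr1.
Qed.

(** Bernoulli's inequality for real exponents, by concavity of the logarithm. *)
Lemma bernoulli_powR (R : realType) (x g : R) : 0 <= x -> 1 <= g ->
  1 + g * x <= (1 + x) `^ g.
Proof.
move=> x0 g1; have g0 : 0 < g by lra.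
have i0 : 0 <= g^-1 by rewrite invr_ge0 ltW.
have i1 : g^-1 <= 1 by rewrite invf_le1.
have a0 : 0 < 1 + g * x by rewrite ltr_pwDl// mulr_ge0// ltW.
have := @concave_ln R (Itv01 i0 i1) (1 + g * x) 1 a0 ltr01.
rewrite !convRE/= ln1 mulr0 addr0 /unstable.onem.
have -> : g^-1 * (1 + g * x) + (1 - g^-1) * 1 = 1 + x by field; rewrite gt_eqF.
rewrite ler_pdivrMl// => H.
rewrite -ler_ln ?posrE// ?ln_powR//.
by rewrite powR_gt0// ltr_pwDl.
Qed.

(** The ratio of consecutive terms is governed by Bernoulli's inequality at
[x = 1 / n.+1]. *)
Lemma gauss_nonincreasing (R : realType) (g : R) : 1 <= g ->
  nonincreasing_seq (fun n => gauss n g).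
Proof.
move=> g1; apply/nonincreasing_seqP => n; have g0 : 0 < g by lra.
have p0 (k : nat) : 0 < k.+1%:R :> R by [].
have q0 (k : nat) : 0 < k.+1%:R `^ g :> R by rewrite powR_gt0.
have H : (g + n.+1%:R) / n.+1%:R <= n.+2%:R `^ g / n.+1%:R `^ g.
  have := @bernoulli_powR R (n.+1%:R^-1) g _ g1; rewrite invr_ge0 => /(_ (ltW (p0 n))) H.
  rewrite mulrDl divff ?gt_eqF// addrC; apply: le_trans H _.
  have -> : 1 + n.+1%:R^-1 = n.+2%:R * n.+1%:R^-1 :> R.
    by rewrite -[in RHS]natr1 mulrDl divff ?gt_eqF// mul1r.
  rewrite powRM ?invr_ge0//.
  by rewrite -[n.+1%:R^-1]powR_inv1// powRAC powR_inv1 ?powR_ge0.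
rewrite /gauss rbinomS !powRB ?(gt_eqF (p0 _)) ?implybT// !powRr1//.
have -> : n.+2%:R / n.+2%:R `^ g * (rbinom n.+1 g * ((g + n.+1%:R) / n.+2%:R)) =
  (rbinom n.+1 g * n.+1%:R / n.+2%:R `^ g) * ((g + n.+1%:R) / n.+1%:R) :> R.
  by field; rewrite !gt_eqF.
have -> : n.+1%:R / n.+1%:R `^ g * rbinom n.+1 g =
  (rbinom n.+1 g * n.+1%:R / n.+2%:R `^ g) * (n.+2%:R `^ g / n.+1%:R `^ g) :> R.
  by field; rewrite !gt_eqF.
by apply: ler_wpM2l H; rewrite divr_ge0// ?(ltW (q0 _))// mulr_ge0// ltW// rbinom_gt0.
Qed.

Lemma gauss_le_shift (R : realType) (g : R) n : 0 < g ->
  gauss n g <= g * gauss n (g + 1).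
Proof.
move=> g0; rewrite -gauss_shift ler_peMr ?ltW ?gauss_gt0//.
by rewrite ltr_pdivlMr// mul1r ltrDr.
Qed.

Lemma gaussE (R : realType) (g : R) n : 0 < g ->
  n.+1%:R `^ g * n.+1`!%:R / \prod_(i < n.+2) (g + i%:R) =
    ((g / n.+1%:R + 1) * gauss n g)^-1.
Proof.
move=> g0; rewrite big_ord_recr/= /gauss rbinomE.
have p0 (k : nat) : 0 < k.+1%:R :> R by [].
have q0 : 0 < n.+1%:R `^ g :> R by rewrite powR_gt0.
have r0 : 0 < \prod_(i < n.+1) (g + i%:R) :> R.
  by apply: prodr_gt0 => i _; rewrite ltr_pwDl.
have f0 : 0 < n.+1`!%:R :> R by rewrite ltr0n fact_gt0.
rewrite powRB ?(gt_eqF (p0 _)) ?implybT// powRr1//.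
by field; rewrite [1 + _]addrC natr1 !gt_eqF// addr_gt0.
Qed.

(** The products in Gauss's formula are bounded below, since [gauss n g] is at
most [g * gauss 0 (g + 1) = g (g + 1)]. *)
Lemma Gamma_gt0 (R : realType) (g : R) : 0 < g -> 0 < Gamma g.
Proof.
move=> g0; have H := cvg_Gamma_gauss g0.
suff : ((g + 1) * (g * (g + 1)))^-1 <= Gamma g.
  by apply: lt_le_trans; rewrite invr_gt0 !mulr_gt0// addr_gt0.
rewrite -(cvg_lim (@norm_hausdorff _ _) H); apply: limr_ge (cvgP _ H) _.
apply: nearW => n; rewrite gaussE//.
have gp := gauss_gt0 n g0.
have d0 : 0 <= g / n.+1%:R by rewrite divr_ge0// ltW.
have d1 : 0 < g / n.+1%:R + 1 by rewrite ltr_wpDl.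
rewrite lef_pV2 ?posrE ?(mulr_gt0 d1 gp) ?mulr_gt0 ?addr_gt0//.
apply: ler_pM => //; [exact: ltW|exact: ltW| |].
  by rewrite lerD2r ler_pdivrMr// ler_peMr ?(ltW g0)// ler1n.
apply: le_trans (gauss_le_shift _ g0) _; rewrite ler_pM2l//.
have g1 : 1 <= g + 1 by lra.
apply: le_trans (gauss_nonincreasing g1 (leq0n n)) _.
by rewrite /gauss rbinomS rbinom0 powR1 !mul1r addr0 divr1.
Qed.

Lemma cvg_gauss (R : realType) (g : R) : 0 < g ->
  gauss n g @[n --> \oo] --> (Gamma g)^-1.
Proof.
move=> g0; have G0 := Gamma_gt0 g0.
have H := cvgV (lt0r_neq0 G0) (cvg_Gamma_gauss g0).
have H1 : g / n.+1%:R + 1 @[n --> \oo] --> (1 : R).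
  rewrite -[X in _ --> X]add0r; apply: cvgD; [exact: cvg_divr_succn|exact: cvg_cst].
have H2 := cvgM (H _) (cvgV (oner_neq0 R) H1).
rewrite invr1 mulr1 in H2.
rewrite [X in X @ _ --> _](_ : _ = fun n => (n.+1%:R `^ g * n.+1`!%:R /
  \prod_(i < n.+2) (g + i%:R))^-1 * (g / n.+1%:R + 1)^-1); first exact: H2.
apply/funext => n.
have d0 : 0 < g / n.+1%:R + 1 by rewrite ltr_wpDl// divr_ge0// ltW.
by rewrite gaussE// invrK mulrAC divff ?mul1r// gt_eqF.
Qed.

(** Both sides of [gauss_shift] have a limit. *)
Lemma GammaD1 (R : realType) (g : R) : 0 < g -> Gamma (g + 1) = g * Gamma g.
Proof.
move=> g0; have g10 : 0 < g + 1 by lra.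
have H1 : g * gauss n (g + 1) @[n --> \oo] --> g * (Gamma (g + 1))^-1.
  by apply: cvgM; [exact: cvg_cst|exact: cvg_gauss].
have H2 : g * gauss n (g + 1) @[n --> \oo] --> (Gamma g)^-1 * 1.
  under eq_fun do rewrite -gauss_shift.
  apply: cvgM; first exact: cvg_gauss.
  rewrite -[X in _ --> X]add0r.
  under eq_fun do rewrite mulrDl divff ?pnatr_eq0//.
  apply: cvgD; [exact: cvg_divr_succn|exact: cvg_cst].
have := cvg_unique _ H1 H2; rewrite mulr1 => /(_ (@norm_hausdorff _ _)) E.
have G0 := Gamma_gt0 g0; have G1 := Gamma_gt0 g10.
transitivity ((Gamma g)^-1 * (Gamma g * Gamma (g + 1))).
  by field; rewrite gt_eqF.
by rewrite -E; field; rewrite gt_eqF.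
Qed.

(** * Power series *)

(** The sum of the power series of coefficients [a] at [x]; meaningful when the
series converges. *)
Definition psum (R : realType) (a : nat -> R) (x : R) : R := limn (pseries a x).

(** The radius of convergence is at least [rho], stated as Abel's boundedness
condition at every [r < rho]. *)
Definition radius_ge (R : realType) (rho : R) (a : nat -> R) : Prop :=
  forall r, 0 < r -> r < rho -> exists M, forall n, `|a n| * r ^+ n <= M.

Section PowerSeries.
Variable R : realType.
Implicit Types (a b : nat -> R) (rho r x c : R).

Lemma cvg_pseries_norm rho a x : radius_ge rho a -> `|x| < rho ->
  cvgn (pseries (fun n => `|a n|) `|x|).
Proof.
move=> Ha xrho; pose r := (`|x| + rho) / 2.
have r0 : 0 < r by rewrite /r; have := normr_ge0 x; lra.
have xr : `|x| < r by rewrite /r; lra.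
have [||M HM] := Ha r => //; first by rewrite /r; lra.
apply: (@series_le_cvg _ _ (geometric M (`|x| / r))).
- by move=> n; rewrite mulr_ge0// exprn_ge0.
- move=> n; rewrite /geometric/= mulr_ge0//; last by rewrite exprn_ge0// divr_ge0// ltW.
  by apply: le_trans (HM 0); rewrite mulr_ge0.
- move=> n; rewrite /geometric/= expr_div_n mulrA.
  rewrite ler_pdivlMr ?exprn_gt0// mulrAC.
  by apply: ler_wpM2r => //; rewrite exprn_ge0.
apply: is_cvg_geometric_series.
by rewrite normrM normfV normr_id (gtr0_norm r0) ltr_pdivrMr// mul1r.
Qed.

Lemma is_cvg_psum rho a x : radius_ge rho a -> `|x| < rho -> cvgn (pseries a x).
Proof.
move=> Ha xrho; apply: normed_cvg.
have := cvg_pseries_norm Ha xrho; rewrite /pseries /=.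
by under eq_fun do rewrite -normrX -normrM.
Qed.

Lemma cvg_psum rho a x : radius_ge rho a -> `|x| < rho ->
  pseries a x n @[n --> \oo] --> psum a x.
Proof. exact: is_cvg_psum. Qed.

Lemma psumE a x (l : R) : pseries a x n @[n --> \oo] --> l -> psum a x = l.
Proof. by move=> /(cvg_lim (@norm_hausdorff _ _)). Qed.

Lemma eq_psum a b x : a =1 b -> psum a x = psum b x.
Proof. by move=> ab; congr (psum _ x); apply/funext. Qed.

Lemma eq_radius_ge rho a b : a =1 b -> radius_ge rho a -> radius_ge rho b.
Proof. by move=> /funext ->. Qed.

Lemma radius_geS rho a : radius_ge rho a -> radius_ge rho (fun n => a n.+1).
Proof.
move=> Ha r r0 rr; have [M HM] := Ha r r0 rr; exists (M / r) => n.
by rewrite ler_pdivlMr// -mulrA -exprSr.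
Qed.

Lemma radius_geD rho a b : radius_ge rho a -> radius_ge rho b ->
  radius_ge rho (fun n => a n + b n).
Proof.
move=> Ha Hb r r0 rr; have [M HM] := Ha r r0 rr; have [N HN] := Hb r r0 rr.
exists (M + N) => n; apply: le_trans (lerD (HM n) (HN n)); rewrite -mulrDl.
by rewrite ler_wpM2r ?exprn_ge0 ?(ltW r0)// ler_normD.
Qed.

Lemma radius_geZ rho c a : radius_ge rho a -> radius_ge rho (fun n => c * a n).
Proof.
move=> Ha r r0 rr; have [M HM] := Ha r r0 rr; exists (`|c| * M) => n.
by rewrite normrM -mulrA ler_wpM2l.
Qed.

Lemma radius_ge_natM rho a : radius_ge rho a -> radius_ge rho (fun n => n%:R * a n).
Proof.
move=> Ha r r0 rr; pose s := (r + rho) / 2.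
have s0 : 0 < s by rewrite /s; lra.
have rs : r < s by rewrite /s; lra.
have [||M HM] := Ha s => //; first by rewrite /s; lra.
pose t := r / s; have t0 : 0 <= t by rewrite divr_ge0 ?ltW.
have t1 : t < 1 by rewrite ltr_pdivrMr// mul1r.
have nt n : n%:R * t ^+ n <= (1 - t)^-1.
  (* each of the [n] first terms of the geometric series is at least [t ^+ n] *)
  have -> : n%:R * t ^+ n = \sum_(i < n) t ^+ n.
    by rewrite sumr_const card_ord mulr_natl.
  apply: (@le_trans _ _ (\sum_(i < n) t ^+ i)).
    apply: ler_sum => i _; apply: ler_wiXn2l => //; [exact: ltW|exact: ltnW].
  rewrite -[leRHS]mulr1 -ler_pdivrMl ?invr_gt0 ?subr_gt0// invrK.
  by rewrite -[1 - t]opprB mulNr -subrX1 opprB lerBlDr lerDl exprn_ge0.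
have M0 : 0 <= M by apply: le_trans (HM 0%N); rewrite mulr_ge0.
exists ((1 - t)^-1 * M) => n.
rewrite normrM ger0_norm//.
have -> : n%:R * `|a n| * r ^+ n = (n%:R * t ^+ n) * (`|a n| * s ^+ n).
  by rewrite /t expr_div_n; field; rewrite expf_neq0// gt_eqF.
apply: ler_pM => //; first by rewrite mulr_ge0// exprn_ge0.
by rewrite mulr_ge0// exprn_ge0// ltW.
Qed.

Lemma radius_ge_affineM rho (A B : R) a : radius_ge rho a ->
  radius_ge rho (fun n => (A + B * n%:R) * a n).
Proof.
move=> Ha; apply: (@eq_radius_ge _ (fun n => A * a n + B * (n%:R * a n))).
  by move=> n; ring.
by apply: radius_geD; apply: radius_geZ => //; exact: radius_ge_natM.
Qed.

Lemma radius_ge_diffs rho a : radius_ge rho a -> radius_ge rho (pseries_diffs a).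
Proof. by move=> /radius_ge_natM/radius_geS. Qed.

Lemma is_derive_psum rho a x : radius_ge rho a -> `|x| < rho ->
  is_derive x 1 (psum a) (psum (pseries_diffs a) x).
Proof.
move=> Ha xrho; pose K := (`|x| + rho) / 2.
have K0 : 0 < K by rewrite /K; have := normr_ge0 x; lra.
have Kr : `|K| < rho by rewrite gtr0_norm// /K; lra.
apply: (@pseries_snd_diffs _ _ K).
- exact: is_cvg_psum Ha Kr.
- exact: is_cvg_psum (radius_ge_diffs Ha) Kr.
- exact: is_cvg_psum (radius_ge_diffs (radius_ge_diffs Ha)) Kr.
- by rewrite (gtr0_norm K0) /K; lra.
Qed.

Lemma psumD rho a b x : radius_ge rho a -> radius_ge rho b -> `|x| < rho ->
  psum (fun n => a n + b n) x = psum a x + psum b x.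
Proof.
move=> Ha Hb xr; apply: psumE.
rewrite [X in X @ _](_ : _ = fun n => pseries a x n + pseries b x n).
  by apply: cvgD; [exact: cvg_psum Ha xr|exact: cvg_psum Hb xr].
apply/funext => n; rewrite /pseries /series/= -big_split/=.
by apply: eq_bigr => i _; rewrite mulrDl.
Qed.

Lemma psumZ rho c a x : radius_ge rho a -> `|x| < rho ->
  psum (fun n => c * a n) x = c * psum a x.
Proof.
move=> Ha xr; apply: psumE.
rewrite [X in X @ _](_ : _ = fun n => c * pseries a x n).
  by apply: cvgM; [exact: cvg_cst|exact: cvg_psum Ha xr].
apply/funext => n; rewrite /pseries /series/= mulr_sumr.
by apply: eq_bigr => i _; rewrite mulrA.
Qed.

Lemma psum_recl rho a x : radius_ge rho a -> `|x| < rho ->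
  psum a x = a 0%N + x * psum (fun n => a n.+1) x.
Proof.
move=> Ha xr; apply: psumE; rewrite -cvg_shiftS /=.
rewrite [X in X @ _](_ : _ = fun n => a 0%N + x * pseries (fun n => a n.+1) x n).
  apply: cvgD; first exact: cvg_cst.
  by apply: cvgM; [exact: cvg_cst|exact: cvg_psum (radius_geS Ha) xr].
apply/funext => n; rewrite /pseries /series/= big_nat_recl//= expr0 mulr1 mulr_sumr.
by congr (_ + _); apply: eq_bigr => i _; rewrite exprS mulrCA.
Qed.

Lemma psum0 a : psum a 0 = a 0%N.
Proof.
apply: psumE; rewrite -cvg_shiftS; apply: cvg_near_cst.
apply: nearW => n; rewrite /pseries /series /= big_nat_recl//.
by rewrite expr0 mulr1 big1 ?addr0// => i _; rewrite exprS mul0r mulr0.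
Qed.

Lemma radius_ge_sum rho n (f : nat -> nat -> R) (c : nat -> R) :
  (forall i, radius_ge rho (f i)) ->
  radius_ge rho (fun j => \sum_(i < n) c i * f i j).
Proof.
move=> Hf; elim: n => [|n IH].
  apply: (@eq_radius_ge _ (fun=> 0)); first by move=> j; rewrite big_ord0.
  by move=> r _ _; exists 0 => j; rewrite normr0 mul0r.
apply: (@eq_radius_ge _ (fun j => \sum_(i < n) c i * f i j + c n * f n j)).
  by move=> j; rewrite big_ord_recr.
by apply: radius_geD => //; exact: radius_geZ.
Qed.

Lemma psum_sum rho n (f : nat -> nat -> R) (c : nat -> R) x :
  (forall i, radius_ge rho (f i)) -> `|x| < rho ->
  psum (fun j => \sum_(i < n) c i * f i j) x = \sum_(i < n) c i * psum (f i) x.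
Proof.
move=> Hf xr; elim: n => [|n IH].
  rewrite big_ord0; apply: psumE; apply: cvg_near_cst; apply: nearW => k.
  by rewrite /pseries /series/= big1// => i _; rewrite big_ord0 mul0r.
rewrite big_ord_recr/= -IH -(psumZ (c n) (Hf n) xr).
rewrite -(psumD (radius_ge_sum _ _ Hf) (radius_geZ _ (Hf n)) xr).
by apply: eq_psum => j; rewrite big_ord_recr.
Qed.

End PowerSeries.

Lemma psum_split (R : realType) (rho : R) (a : nat -> R) (x : R) m :
  radius_ge rho a -> `|x| < rho ->
  psum a x = \sum_(i < m) a i * x ^+ i + x ^+ m * psum (fun n => a (m + n)%N) x.
Proof.
move=> Ha xr; elim: m => [|m IH].
  by rewrite big_ord0 add0r expr0 mul1r.
rewrite IH big_ord_recr/= -addrA; congr (_ + _).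
have H : radius_ge rho (fun n => a (m + n)%N).
  elim: (m) => // i Hi; apply: eq_radius_ge (radius_geS Hi) => n.
  by rewrite addSn addnS.
rewrite (psum_recl H xr) addn0 mulrDr mulrA -exprSr [_ * a m]mulrC.
by congr (_ + _ * _); apply: eq_psum => n; rewrite addSn addnS.
Qed.

(** The sequence [|rbinom n g| r ^ n] is eventually nonincreasing. *)
Lemma radius_ge_rbinom (R : realType) (g : R) : radius_ge 1 (fun j => rbinom j g).
Proof.
move=> r r0 r1.
pose u n := `|rbinom n g| * r ^+ n.
have [J HJ] : exists J, forall n, (J <= n)%N -> r * (`|g| + n%:R) <= n.+1%:R.
  pose J := (Num.trunc (r * `|g| / (1 - r))).+1.
  have h : r * `|g| / (1 - r) <= J%:R.
    have /andP[_ /ltW] : (Num.trunc (r * `|g| / (1 - r)))%:R <=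
      r * `|g| / (1 - r) < J%:R => //.
    by apply: truncn_itv; rewrite divr_ge0 ?mulr_ge0 ?subr_ge0 ?(ltW r0) ?(ltW r1).
  exists J => n Jn; move: h; rewrite ler_pdivrMr ?subr_gt0// => h.
  have nJ : J%:R <= n%:R :> R by rewrite ler_nat.
  have : J%:R * (1 - r) <= n%:R * (1 - r) by rewrite ler_wpM2r// subr_ge0 ltW.
  by rewrite -natr1; lra.
have uS n : (J <= n)%N -> u n.+1 <= u n.
  move=> /HJ h; rewrite /u rbinomS normrM exprS.
  have -> : `|rbinom n g| * `|(g + n%:R) / n.+1%:R| * (r * r ^+ n) =
    (`|rbinom n g| * r ^+ n) * (r * `|(g + n%:R) / n.+1%:R|) by ring.
  apply: ler_piMr; first by rewrite mulr_ge0// exprn_ge0// ltW.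
  rewrite normrM normfV (ger0_norm (ler0n _ n.+1)) mulrA ler_pdivrMr// mul1r.
  apply: le_trans h; apply: ler_wpM2l; first exact: ltW.
  by apply: le_trans (ler_normD _ _) _; rewrite (ger0_norm (ler0n _ _)).
have u0 n : 0 <= u n by rewrite mulr_ge0// exprn_ge0// ltW.
exists (\sum_(i < J.+1) u i) => n; rewrite -/(u n).
have le1 i : (i <= J)%N -> u i <= \sum_(i < J.+1) u i.
  move=> iJ; rewrite (bigD1 (Ordinal (iJ : (i < J.+1)%N)))//= lerDl.
  exact: sumr_ge0.
have [/le1 //|] := leqP n J.
elim: n => // n IH; rewrite ltnS leq_eqVlt => /orP[/eqP <-|Jn].
  by apply: le_trans (uS _ (leqnn _)) _; exact: le1.
by apply: le_trans (uS _ (ltnW Jn)) _; exact: IH.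
Qed.

(** The binomial series: its sum [f] solves [(1 - x) f' = g f], so
[f (x) (1 - x) ^ g] has derivative zero. *)
Lemma psum_rbinom (R : realType) (g y : R) : 0 <= y < 1 ->
  psum (fun j => rbinom j g) y = (1 - y) `^ (- g).
Proof.
move=> /andP[y0 y1].
pose f := psum (fun j => rbinom j g).
have Hr := @radius_ge_rbinom R g.
pose df x := psum (pseries_diffs (fun j => rbinom j g)) x.
have ode x : `|x| < 1 -> (1 - x) * df x = g * f x.
  move=> x1; rewrite mulrBl mul1r.
  have E : df x = g * f x + psum (fun n => n%:R * rbinom n g) x.
    rewrite /df /f -(psumZ g Hr x1) -(psumD (radius_geZ _ Hr) (radius_ge_natM Hr) x1).
    apply: eq_psum => n; rewrite /pseries_diffs rbinomS mulrCA.
    by rewrite [n.+1%:R * _]mulrC divfK// mulrDr ![rbinom n g * _]mulrC.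
  have E2 : psum (fun n => n%:R * rbinom n g) x = x * df x.
    by rewrite (psum_recl (radius_ge_natM Hr) x1) mul0r add0r.
  by rewrite {1}E E2 addrK.
pose h (x : R) := f x * (1 - x) `^ g.
have dh (x : R) : `|x| < 1 -> is_derive x 1 h 0.
  move=> x1; have := ltr_norml x 1; rewrite x1 => /esym/andP[_ xlt1].
  have x10 : 0 < 1 - x by lra.
  have d1 := is_derive_psum Hr x1.
  have d2 := @is_derive1_powR R g _ x10.
  have d3 := is_deriveB (is_derive_cst (1 : R) x 1) (is_derive_id x (1 : R)).
  have d4 := @is_derive1_comp R (@powR R ^~ g) (cst 1 - id) x _ _ d2 d3.
  apply: is_derive_eq (is_deriveM d1 d4) _.
  rewrite -/(df x) -/(f x) /GRing.scale /=.
  have -> : (1 - x) `^ g = (1 - x) `^ (g - 1) * (1 - x).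
    by rewrite powRB ?(gt_eqF x10) ?implybT// powRr1 ?(ltW x10)// divfK ?gt_eqF.
  have /eqP := ode _ x1; rewrite -subr_eq0 => /eqP E.
  transitivity ((1 - x) `^ (g - 1) * ((1 - x) * df x - g * f x)); first by simpl; ring.
  by rewrite E mulr0.
have [->|yn0] := eqVneq y 0.
  by rewrite psum0 rbinom0 subr0 powR1.
have yp : 0 < y by rewrite lt_neqAle eq_sym yn0.
have [||c _] := @MVT R h (fun=> 0) 0 y yp.
- move=> x; rewrite in_itv/= => /andP[x0 xy]; apply: dh.
  by rewrite ger0_norm ?(ltW x0)// (lt_trans xy).
- apply: derivable_within_continuous => x; rewrite in_itv/= => /andP[x0 xy].
  have [] := dh x; last by [].
  by rewrite ger0_norm// (le_lt_trans xy).
rewrite mul0r => /eqP; rewrite subr_eq0 => /eqP.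
rewrite /h /f psum0 rbinom0 subr0 powR1 mulr1 => E.
have p0 : 0 < (1 - y) `^ g by rewrite powR_gt0// subr_gt0.
by apply: (mulIf (lt0r_neq0 p0)); rewrite E powRN mulVf ?gt_eqF.
Qed.

(** * Complete monotonicity by finite differences *)

(** On [(0, L)], [f] is nonnegative and so are its iterated differences
[f x - f (x + h)] up to order [n], for all positive steps that stay in the
interval (the steps need not be equal).  The bound [L] shrinks by [h] at each
step, and the predicate holds trivially when [L <= 0]. *)
Fixpoint diff_mono (R : realType) (n : nat) (L : R) (f : R -> R) : Prop :=
  (forall x, 0 < x -> x < L -> 0 <= f x) /\
  match n with
  | 0 => True
  | m.+1 => forall h, 0 < h -> diff_mono m (L - h) (fun x => f x - f (x + h))
  end.

Section DiffMono.
Variable R : realType.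
Implicit Types (f g : R -> R) (L x c : R).

Lemma diff_mono_ge0 n L f x : diff_mono n L f -> 0 < x -> x < L -> 0 <= f x.
Proof. by case: n => [|n] [H _]; exact: H. Qed.

Lemma eq_diff_mono n L f g : (forall x, 0 < x -> x < L -> f x = g x) ->
  diff_mono n L f -> diff_mono n L g.
Proof.
elim: n L f g => [|n IH] L f g fg [H1 H2]; split => //.
- by move=> x x0 xL; rewrite -fg//; exact: H1.
- by move=> x x0 xL; rewrite -fg//; exact: H1.
move=> h h0; apply: IH (H2 h h0) => x x0 xL.
by rewrite !fg//; lra.
Qed.

Lemma diff_mono_le n L L' f : L' <= L -> diff_mono n L f -> diff_mono n L' f.
Proof.
elim: n L L' f => [|n IH] L L' f LL [H1 H2]; split => //.
- by move=> x x0 xL; apply: H1 => //; lra.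
- by move=> x x0 xL; apply: H1 => //; lra.
by move=> h h0; apply: IH (H2 h h0); lra.
Qed.

Lemma diff_monoW n L f : diff_mono n.+1 L f -> diff_mono n L f.
Proof.
elim: n L f => [|n IH] L f [H1 H2]; split => //.
by move=> h h0; apply: IH; exact: H2.
Qed.

Lemma diff_mono_shift n L f h : 0 < h -> diff_mono n L f ->
  diff_mono n (L - h) (fun x => f (x + h)).
Proof.
elim: n L f => [|n IH] L f h0 [H1 H2]; split => //.
- by move=> x x0 xL; apply: H1; lra.
- by move=> x x0 xL; apply: H1; lra.
move=> k k0; have := IH _ _ h0 (H2 k k0).
rewrite addrAC; apply: eq_diff_mono => x _ _.
by rewrite addrAC.
Qed.

Lemma diff_monoD n L f g : diff_mono n L f -> diff_mono n L g ->
  diff_mono n L (fun x => f x + g x).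
Proof.
elim: n L f g => [|n IH] L f g [F1 F2] [G1 G2]; split => //.
- by move=> x x0 xL; rewrite addr_ge0 ?F1 ?G1.
- by move=> x x0 xL; rewrite addr_ge0 ?F1 ?G1.
move=> h h0; apply: eq_diff_mono (IH _ _ _ (F2 h h0) (G2 h h0)) => x _ _.
by ring.
Qed.

(** By the Leibniz rule
[f g x - f g (x + h) = (f x - f (x + h)) g x + f (x + h) (g x - g (x + h))]. *)
Lemma diff_monoM n L f g : diff_mono n L f -> diff_mono n L g ->
  diff_mono n L (fun x => f x * g x).
Proof.
elim: n L f g => [|n IH] L f g Hf Hg; split => //.
- by move=> x x0 xL; rewrite mulr_ge0// (diff_mono_ge0 Hf, diff_mono_ge0 Hg).
- by move=> x x0 xL; rewrite mulr_ge0// (diff_mono_ge0 Hf, diff_mono_ge0 Hg).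
move=> h h0; have [_ F2] := Hf; have [_ G2] := Hg.
have Lh : L - h <= L by lra.
have Ha := IH _ _ _ (F2 h h0) (diff_mono_le Lh (diff_monoW Hg)).
have Hb := IH _ _ _ (diff_mono_shift h0 (diff_monoW Hf)) (G2 h h0).
by apply: eq_diff_mono (diff_monoD Ha Hb) => x _ _; ring.
Qed.

Lemma diff_mono_cst n L c : 0 <= c -> diff_mono n L (fun=> c).
Proof.
elim: n L c => [|n IH] L c c0; split => // h h0.
by apply: (@eq_diff_mono _ _ (fun=> 0)) (IH _ 0 _) => // x _ _; rewrite subrr.
Qed.

Lemma diff_mono_sum n L k (F : nat -> R -> R) :
  (forall i, (i < k)%N -> diff_mono n L (F i)) ->
  diff_mono n L (fun x => \sum_(i < k) F i x).
Proof.
elim: k => [|k IH] HF.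
  apply: (@eq_diff_mono _ _ (fun=> 0)); last exact: diff_mono_cst.
  by move=> x _ _; rewrite big_ord0.
apply: (@eq_diff_mono _ _ (fun x => \sum_(i < k) F i x + F k x)).
  by move=> x _ _; rewrite big_ord_recr.
apply: diff_monoD; last exact: HF.
by apply: IH => i ik; apply: HF; rewrite ltnS ltnW.
Qed.

Lemma diff_mono_onem n : diff_mono n 1 (fun x : R => 1 - x).
Proof.
case: n => [|n]; split => //; try by move=> x _ x1; lra.
move=> h h0; apply: (@eq_diff_mono _ _ (fun=> h)); last exact/diff_mono_cst/ltW.
by move=> x _ _; ring.
Qed.

Lemma diff_mono_onemX n k : diff_mono n 1 (fun x : R => (1 - x) ^+ k).
Proof.
elim: k => [|k IH].
  by apply: (@eq_diff_mono _ _ (fun=> 1)) (diff_mono_cst _ _ ler01) => x _ _; rewrite expr0.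
apply: (@eq_diff_mono _ _ (fun x => (1 - x) * (1 - x) ^+ k)).
  by move=> x _ _; rewrite exprS.
by apply: diff_monoM => //; exact: diff_mono_onem.
Qed.

Lemma diff_mono_lim n L (F : nat -> R -> R) f :
  (forall x, 0 < x -> x < L -> F k x @[k --> \oo] --> f x) ->
  (\forall k \near \oo, diff_mono n L (F k)) -> diff_mono n L f.
Proof.
elim: n L F f => [|n IH] L F f Ff HF.
  split => // x x0 xL; rewrite -(cvg_lim (@norm_hausdorff _ _) (Ff x x0 xL)).
  apply: limr_ge; first exact: (cvgP _ (Ff x x0 xL)).
  by apply: filterS HF => k Hk; exact: diff_mono_ge0 Hk x0 xL.
split => [x x0 xL|h h0].
  rewrite -(cvg_lim (@norm_hausdorff _ _) (Ff x x0 xL)).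
  apply: limr_ge; first exact: (cvgP _ (Ff x x0 xL)).
  by apply: filterS HF => k Hk; exact: diff_mono_ge0 Hk x0 xL.
apply: (IH _ (fun k x => F k x - F k (x + h))).
  by move=> x x0 xL; apply: cvgB; apply: Ff; lra.
by apply: filterS HF => k [_]; apply.
Qed.

Lemma diff_mono_scale n L c f : 0 < c -> diff_mono n L f ->
  diff_mono n (L / c) (fun x => f (c * x)).
Proof.
elim: n L f => [|n IH] L f c0 [H1 H2].
  by split => // x x0; rewrite ltr_pdivlMr// mulrC => xL; apply: H1 => //; rewrite mulr_gt0.
split => [x x0|h h0].
  by rewrite ltr_pdivlMr// mulrC => xL; apply: H1 => //; rewrite mulr_gt0.
have ch : 0 < c * h by rewrite mulr_gt0.
have := IH _ _ c0 (H2 _ ch).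
have -> : (L - c * h) / c = L / c - h by field; rewrite gt_eqF.
by apply: eq_diff_mono => x _ _; rewrite mulrDr.
Qed.

Lemma diff_mono_psum n (a : nat -> R) : (forall j, 0 <= a j) -> radius_ge 1 a ->
  diff_mono n 1 (fun x => psum a (1 - x)).
Proof.
move=> a0 Ha; apply: (@diff_mono_lim _ _ (fun k x => \sum_(i < k) a i * (1 - x) ^+ i)).
  move=> x x0 x1; have y1 : `|1 - x| < 1 by rewrite ger0_norm; lra.
  have := cvg_psum Ha y1; rewrite /pseries /series/=.
  by under eq_fun do rewrite big_mkord.
apply: nearW => k; apply: (@diff_mono_sum n 1 k (fun i x => a i * (1 - x) ^+ i)) => i _.
by apply: diff_monoM; [exact: diff_mono_cst|exact: diff_mono_onemX].
Qed.

(** The function is the binomial series in [1 - x], whose coefficients are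
nonnegative. *)
Lemma diff_mono_powR1 n (s : R) : 0 <= s -> diff_mono n 1 (fun x => x `^ (- s)).
Proof.
move=> s0; apply: (@eq_diff_mono _ _ (fun x => psum (fun j => rbinom j s) (1 - x))).
  move=> x x0 x1; rewrite psum_rbinom; last lra.
  by congr (_ `^ _); ring.
by apply: diff_mono_psum; [move=> j; exact: rbinom_ge0|exact: radius_ge_rbinom].
Qed.

Lemma diff_mono_powR n L (s : R) : 0 <= s -> diff_mono n L (fun x => x `^ (- s)).
Proof.
move=> s0; have [L0|L0] := ltP 0 L; last first.
  apply: (@eq_diff_mono _ _ (fun=> 0)); last exact: diff_mono_cst.
  by move=> x x0 xL; lra.
have iL : 0 < L^-1 by rewrite invr_gt0.
have := diff_mono_scale iL (diff_mono_powR1 n s0); rewrite div1r invrK => H.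
apply: eq_diff_mono (diff_monoM (diff_mono_cst n L (powR_ge0 L (- s))) H) => x x0 _.
by rewrite powRM ?ltW// mulrA -powRM ?ltW// divff ?gt_eqF// powR1 mul1r.
Qed.

End DiffMono.

(** * Nonnegative expansions *)

(** Since [(s + 1 + k) rbinom k (s + 1) = (k + 1) rbinom k.+1 (s + 1)], multiplying
the expansion at rank [N] by [beta + alpha s + N] gives the recurrence
[(N + 1) A'_k = (N + beta - alpha - alpha k) A_k + alpha k A_(k - 1)], whose
factors are nonnegative for [k <= N]. *)
Lemma rbinom_affine_expansion (R : realType) (alpha beta : R) (N : nat) :
  0 <= alpha -> alpha <= 1 -> alpha <= beta ->
  exists A : nat -> R, (forall k, 0 <= A k) /\
    forall s : R, rbinom N (beta + alpha * s) =
                  \sum_(k < N.+1) A k * rbinom k (s + 1).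
Proof.
move=> a0 a1 ab.
(* the vanishing beyond [N] is needed in the induction, where the factor
   [N + beta - alpha - alpha k] can be negative for [k > N] *)
suff [A [A0 [_ AE]]] : exists A : nat -> R, (forall k, 0 <= A k) /\
    (forall k, (N < k)%N -> A k = 0) /\
    forall s : R, rbinom N (beta + alpha * s) =
                  \sum_(k < N.+1) A k * rbinom k (s + 1).
  by exists A.
elim: N => [|N [A [A0 [AN AE]]]].
  exists (fun k => (k == 0%N)%:R); split; first by move=> k; exact: ler0n.
  split; first by case.
  by move=> s; rewrite big_ord1 !rbinom0 mulr1.
pose B k := (N%:R + beta - alpha - alpha * k%:R) * A k.
pose C k := alpha * k%:R * A k.-1.
exists (fun k => (B k + C k) / N.+1%:R); split; last split.
- move=> k; rewrite divr_ge0// addr_ge0//; last by rewrite /C !mulr_ge0.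
  rewrite /B; have [kN|kN] := leqP k N; last by rewrite AN// mulr0.
  apply: mulr_ge0 => //.
  have : k%:R <= N%:R :> R by rewrite ler_nat.
  have := ler0n R k; nra.
- case=> // k kN; rewrite /B /C /= !AN ?mulr0 ?addr0 ?mul0r//.
  exact: leqW.
- move=> s; rewrite rbinomS AE.
  under [RHS]eq_bigr do rewrite mulrAC.
  rewrite -mulr_suml mulrA; congr (_ / _).
  under [RHS]eq_bigr do rewrite mulrDl.
  rewrite big_split/= [X in _ = X + _]big_ord_recr/= {2}/B AN// mulr0 mul0r addr0.
  rewrite [X in _ = _ + X]big_ord_recl/= {1}/C mulr0 !mul0r add0r.
  rewrite -big_split/= mulr_suml; apply: eq_bigr => k _.
  rewrite /bump/= add1n /B /C /= rbinomS -[k.+1%:R]natr1; field.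
  by rewrite ?natr1 ?nat1r ?pnatr_eq0.
Qed.

Section Kernel.
Variables (R : realType) (q : R).
Hypotheses (q0 : 0 <= q) (q1 : q <= 1).

(** For [j > 0], the coefficient of [y ^ j] in [1 - (1 - y) ^ q]; the value
[b 0 = -1] makes these the coefficients of [- (1 - y) ^ q]. *)
Let b (j : nat) : R := - rbinom j (- q).

Lemma onem_powR_coef_ge0 j : 0 <= b j.+1.
Proof.
elim: j => [|j IH]; first by rewrite /b rbinomS rbinom0 addr0 divr1 mul1r opprK.
rewrite /b rbinomS -mulNr mulr_ge0// divr_ge0//.
by rewrite -natr1; have := ler0n R j; move: q0 q1; lra.
Qed.

Lemma radius_ge_onem_powR_tail k : radius_ge 1 (fun j => b (k.+1 + j)).
Proof.
have H : radius_ge 1 b.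
  by apply: eq_radius_ge (radius_geZ (-1) (@radius_ge_rbinom R (- q))) => n; rewrite mulN1r.
elim: k => [|k IH].
  by apply: eq_radius_ge (radius_geS H) => n; rewrite add1n.
by apply: eq_radius_ge (radius_geS IH) => n; rewrite !addSn addnS.
Qed.

Lemma radius_ge_const1 : radius_ge 1 (fun=> 1 : R).
Proof.
by move=> r r0 r1; exists 1 => n; rewrite normr1 mul1r exprn_ile1 ?ltW.
Qed.

Lemma radius_ge_rbinom_affine k (u v : R) :
  radius_ge 1 (fun n => rbinom k (u + v * n%:R)).
Proof.
elim: k => [|k IH].
  by apply: eq_radius_ge radius_ge_const1 => n; rewrite rbinom0.
have := radius_geZ (k.+1%:R^-1) (radius_ge_affineM (u + k%:R) v IH).
apply: eq_radius_ge => n; rewrite rbinomS.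
have -> : u + k%:R + v * n%:R = u + v * n%:R + k%:R by ring.
by rewrite mulrC mulrAC mulrC.
Qed.

(** For [p = 0] and [`|x| < 1] the sum is [(1 - x) ^ (- k - 1)]. *)
Let W k (p : R) (x : R) := psum (fun n => rbinom k (n%:R + 1 - p)) x.

Lemma radius_ge_rbinom_shift k p : radius_ge 1 (fun n => rbinom k (n%:R + 1 - p) : R).
Proof.
by apply: eq_radius_ge (radius_ge_rbinom_affine k (1 - p) 1) => n; congr rbinom; ring.
Qed.

Lemma psum_rbinom_recurrence k p x : `|x| < 1 -> (1 - x) * W k.+1 p x = W k p x + rbinom k.+1 (- p).
Proof.
move=> x1; have HS := radius_ge_rbinom_shift k.+1 p; have H0 := radius_ge_rbinom_shift k p.
rewrite mulrBl mul1r {1}/W (psum_recl HS x1) -addrA -mulrBr.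
have -> : psum (fun n => rbinom k.+1 (n.+1%:R + 1 - p)) x - W k.+1 p x =
   psum (fun n => rbinom k (n.+1%:R + 1 - p)) x.
  apply/eqP; rewrite subr_eq eq_sym; apply/eqP.
  rewrite /W -(psumD (radius_geS H0) HS x1); apply: eq_psum => n.
  have -> : n.+1%:R + 1 - p = n%:R + 1 - p + 1 :> R by rewrite -natr1; ring.
  by rewrite rbinom_pascal addrC.
rewrite {1}/W (psum_recl H0 x1) add0r.
have -> : 1 - p = - p + 1 by ring.
by rewrite rbinom_pascal; ring.
Qed.

(** Both sides satisfy the same recurrence in [k] after multiplication by
[1 - x]; the case [k = 0] is the binomial series of [x ^ q = (1 - (1 - x)) ^ q]. *)
Lemma kernelE k x : 0 < x -> x < 1 ->
  W k q x - x `^ q * W k 0 x = psum (fun j => b (k.+1 + j)) (1 - x).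
Proof.
move=> x0 x1; have xn : `|x| < 1 by rewrite gtr0_norm.
have yn : `|1 - x| < 1 by rewrite gtr0_norm; lra.
have y0 : 1 - x != 0 by apply: lt0r_neq0; lra.
have recb k' : b k' + (1 - x) * psum (fun j => b (k'.+1 + j)) (1 - x) =
    psum (fun j => b (k' + j)) (1 - x).
  case: k' => [|k'].
    rewrite [RHS](@psum_recl _ 1)//.
    by apply: eq_radius_ge (radius_geZ (-1) (@radius_ge_rbinom R (- q))) => n; rewrite mulN1r.
  rewrite [RHS](psum_recl (radius_ge_onem_powR_tail k') yn) addn0.
  by congr (_ + _ * _); apply: eq_psum => n; rewrite !addSn addnS.
apply: (mulfI y0); elim: k => [|k IH].
  have V (p : R) : (1 - x) * W 0 p x = 1.
    have E : W 0 p x = psum (fun=> 1) x by apply: eq_psum => n; rewrite rbinom0.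
    rewrite E mulrBl mul1r {1}(psum_recl radius_ge_const1 xn); ring.
  rewrite mulrBr V mulrCA V mulr1.
  have := recb 0%N; rewrite {1}/b rbinom0 => E.
  have E2 : psum (fun j => b (0 + j)) (1 - x) = - x `^ q.
    rewrite (@eq_psum _ _ (fun j => -1 * rbinom j (- q))); last by move=> j; rewrite mulN1r.
    rewrite (psumZ (-1) (@radius_ge_rbinom R (- q)) yn) psum_rbinom; last lra.
    by rewrite mulN1r opprK; congr (- (_ `^ _)); ring.
  by rewrite E2 in E; lra.
have {}IH : W k q x - x `^ q * W k 0 x = psum (fun j => b (k.+1 + j)) (1 - x).
  exact: (mulfI y0 IH).
have := recb k.+1; rewrite -IH => E.
rewrite mulrBr mulrCA !psum_rbinom_recurrence//.
have z : rbinom k.+1 (- 0) = 0 :> R.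
  elim: (k) => [|i Hi]; first by rewrite rbinomS oppr0 addr0 mul0r mulr0.
  by rewrite rbinomS Hi mul0r.
by rewrite z addr0; move: E; rewrite /b; lra.
Qed.

Lemma diff_mono_kernel n k :
  diff_mono n 1 (fun x => x `^ (- q) * W k q x - W k 0 x).
Proof.
have H := @diff_mono_psum R n _ (fun j => onem_powR_coef_ge0 (k + j)) (radius_ge_onem_powR_tail k).
apply: eq_diff_mono (diff_monoM (diff_mono_powR1 n q0) H) => x x0 x1.
rewrite -kernelE// mulrBr; congr (_ - _).
by rewrite mulrA -powRD ?(gt_eqF x0) ?implybT// addNr powRr0 mul1r.
Qed.

End Kernel.

(** * Passage to the limit *)

Section Tannery.
Variables (R : realType) (M theta : R).
Hypotheses (theta0 : 0 <= theta) (theta1 : theta < 1).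

Lemma psum_tail (a : nat -> R) (t : R) K :
  (forall n, `|a n * t ^+ n| <= M * theta ^+ n) ->
  `|psum a t - \sum_(i < K) a i * t ^+ i| <= M * theta ^+ K / (1 - theta).
Proof.
move=> H.
have th : 0 < 1 - theta by rewrite subr_gt0.
have M0 : 0 <= M by apply: le_trans (normr_ge0 (a 0%N)) _; have := H 0%N; rewrite !expr0 !mulr1.
have C : cvgn (pseries a t).
  apply: normed_cvg; apply: (@series_le_cvg _ _ (geometric M theta)) => [n|n|n|].
  - exact: normr_ge0.
  - by apply: mulr_ge0 => //; exact: exprn_ge0.
  - exact: H.
  by apply: is_cvg_geometric_series; rewrite ger0_norm.
have B m : `|pseries a t (K + m)%N - \sum_(i < K) a i * t ^+ i| <=
    M * theta ^+ K / (1 - theta).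
  rewrite /pseries /series/= big_mkord big_split_ord/= addrAC subrr add0r.
  apply: le_trans (ler_norm_sum _ _ _) _.
  apply: (@le_trans _ _ (\sum_(i < m) M * theta ^+ K * theta ^+ i)).
    by apply: ler_sum => i _; rewrite -mulrA -exprD; exact: H.
  rewrite -mulr_sumr; apply: ler_wpM2l; first by rewrite mulr_ge0// exprn_ge0.
  rewrite -[leRHS]mulr1 -ler_pdivrMl ?invr_gt0// invrK.
  by rewrite -[1 - theta]opprB mulNr -subrX1 opprB lerBlDr lerDl exprn_ge0.
have C2 : (fun m => `|pseries a t (K + m)%N - \sum_(i < K) a i * t ^+ i|) m
    @[m --> \oo] --> `|psum a t - \sum_(i < K) a i * t ^+ i|.
  apply: cvg_norm; apply: cvgB; last exact: cvg_cst.
  under eq_fun do rewrite addnC.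
  have := C; rewrite -(cvg_shiftn K); exact.
rewrite -(cvg_lim (@norm_hausdorff _ _) C2); apply: limr_le; first exact: (cvgP _ C2).
by apply: nearW => m; exact: B.
Qed.

(** Tannery's theorem. *)
Lemma cvg_psum_dominated (F : nat -> nat -> R) (g : nat -> R) (t : R) N0 :
  (forall N n, (N0 <= N)%N -> `|F N n * t ^+ n| <= M * theta ^+ n) ->
  (forall n, F N n @[N --> \oo] --> g n) ->
  psum (F N) t @[N --> \oo] --> psum g t.
Proof.
move=> HF Fg.
have th : 0 < 1 - theta by rewrite subr_gt0.
have Hg n : `|g n * t ^+ n| <= M * theta ^+ n.
  have C : `|F N n * t ^+ n| @[N --> \oo] --> `|g n * t ^+ n|.
    by apply: cvg_norm; apply: cvgM; [exact: Fg|exact: cvg_cst].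
  rewrite -(cvg_lim (@norm_hausdorff _ _) C); apply: limr_le; first exact: (cvgP _ C).
  by exists N0 => // N /= NN; exact: HF.
apply/cvgrPdist_lt => e e0.
have [K HK] : exists K, M * theta ^+ K / (1 - theta) < e / 3.
  have : M * theta ^+ K / (1 - theta) @[K --> \oo] --> M * 0 / (1 - theta).
    apply: cvgM; last exact: cvg_cst.
    apply: cvgM; first exact: cvg_cst.
    by apply: cvg_expr; rewrite ger0_norm.
  rewrite mulr0 mul0r => /cvgr_lt /(_ (e / 3)) [|K _ HK]; first by rewrite divr_gt0.
  by exists K; apply: HK => /=.
have SK : \sum_(i < K) F N i * t ^+ i @[N --> \oo] --> \sum_(i < K) g i * t ^+ i.
  elim: (K) => [|k IH].
    rewrite big_ord0; under eq_fun do rewrite big_ord0; exact: cvg_cst.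
  rewrite big_ord_recr/=; under eq_fun do rewrite big_ord_recr/=.
  apply: cvgD => //; apply: cvgM; [exact: Fg|exact: cvg_cst].
have e3 : 0 < e / 3 by rewrite divr_gt0.
move/cvgrPdist_lt : SK => /(_ _ e3) SK.
near=> N.
have T1 := psum_tail K Hg.
have NN : (N0 <= N)%N by near: N; exists N0.
have T2 := psum_tail K (fun n => HF N n NN).
have T3 : `|\sum_(i < K) g i * t ^+ i - \sum_(i < K) F N i * t ^+ i| < e / 3 by near: N.
move: T1 T2 T3 HK.
set u := psum g t; set v := psum (F N) t; set x := \sum_(i < K) _; set y := \sum_(i < K) _.
set d := M * _ / _ => T1 T2 T3 HK.
have -> : u - v = (u - x) + (x - y) - (v - y) by ring.
apply: le_lt_trans (ler_normB _ _) _.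
have := ler_normD (u - x) (x - y); lra.
Unshelve. all: by end_near. Qed.

End Tannery.

(** The dominating terms come from a fixed index [N0] with
[t < (N0 + 1) ^ alpha]: for [g = b + alpha n] and [N >= N0], one has
[gauss N g <= g * gauss N (g + 1) <= g * gauss N0 (g + 1)], which is a polynomial
in [n] times [(N0 + 1) ^ (- b - alpha n)].  The shift to [g + 1 >= 1] makes
monotonicity in [N] available even when [g < 1]. *)
Lemma gauss_dominated (R : realType) (alpha b t : R) : 0 < alpha -> 0 < b -> 0 < t ->
  exists N0 M theta, [/\ 0 <= theta, theta < 1 &
    forall N n, (N0 <= N)%N ->
      `|gauss N (b + alpha * n%:R) * t ^+ n| <= M * theta ^+ n].
Proof.
move=> a0 b0 t0.
pose N0 := Num.trunc (t `^ alpha^-1); pose X : R := N0.+1%:R.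
have X0 : 0 < X by [].
have tX : t < X `^ alpha.
  have : t `^ alpha^-1 < X.
    by have /andP[] : N0%:R <= t `^ alpha^-1 < X by apply: truncn_itv; exact: powR_ge0.
  move=> /(gt0_ltr_powR a0); rewrite !nnegrE powR_ge0 (ltW X0) => /(_ isT isT).
  by rewrite -powRrM mulVf ?gt_eqF// powRr1// ltW.
have Xa : 0 < X `^ alpha by rewrite powR_gt0.
pose la := t / X `^ alpha.
have la0 : 0 < la by rewrite divr_gt0.
have la1 : la < 1 by rewrite ltr_pdivrMr// mul1r.
pose theta := (la + 1) / 2.
have th0 : 0 < theta by rewrite /theta; lra.
have th1 : theta < 1 by rewrite /theta; lra.
have lath : la < theta by rewrite /theta; lra.
have Ha := radius_ge_affineM b alpha (radius_ge_rbinom_affine N0.+1 (b + 1) alpha).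
have [||M HM] := Ha (la / theta); first by rewrite divr_gt0.
  by rewrite ltr_pdivrMr// mul1r.
exists N0, (X `^ (- b) * M), theta; split; [exact: ltW|by []|] => N n NN.
have nn := ler0n R n.
have g0 : 0 < b + alpha * n%:R by rewrite ltr_pwDl// mulr_ge0// ltW.
set g := b + alpha * n%:R in g0 *.
have g1 : 1 <= g + 1 by lra.
rewrite ger0_norm; last by rewrite mulr_ge0 ?exprn_ge0 ?ltW// gauss_gt0.
apply: (@le_trans _ _ (g * gauss N0 (g + 1) * t ^+ n)).
  rewrite ler_wpM2r ?exprn_ge0 ?(ltW t0)//.
  apply: le_trans (gauss_le_shift _ g0) _; rewrite ler_pM2l//.
  exact: gauss_nonincreasing.
have -> : g * gauss N0 (g + 1) * t ^+ n =
   X `^ (- b) * ((g * rbinom N0.+1 (g + 1)) * la ^+ n).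
  have -> : gauss N0 (g + 1) = X `^ (- b) * (X `^ alpha) ^- n * rbinom N0.+1 (g + 1).
    rewrite /gauss -/X; congr (_ * _).
    have -> : 1 - (g + 1) = - b - alpha * n%:R by rewrite /g; ring.
    rewrite powRD ?(gt_eqF X0) ?implybT//; congr (_ * _).
    by rewrite powRN powRrM powR_mulrn// powR_ge0.
  by rewrite /la expr_div_n; ring.
rewrite -[leRHS]mulrA ler_pM2l ?powR_gt0//.
have := HM n; rewrite expr_div_n mulrA ler_pdivrMr ?exprn_gt0//.
rewrite -/g; apply: le_trans.
rewrite ler_wpM2r ?exprn_ge0 ?(ltW la0)//.
have -> : g + 1 = b + 1 + alpha * n%:R by rewrite /g; ring.
exact: ler_norm.
Qed.

Lemma cvg_psum_gauss (R : realType) (alpha b t : R) : 0 < alpha -> 0 < b -> 0 < t ->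
  psum (fun n => gauss N (b + alpha * n%:R)) t @[N --> \oo] -->
  psum (fun n => (Gamma (b + alpha * n%:R))^-1) t.
Proof.
move=> a0 b0 t0; have [N0 [M [theta [th0 th1 H]]]] := gauss_dominated a0 b0 t0.
apply: (cvg_psum_dominated th0 th1 H) => n.
by apply: cvg_gauss; rewrite ltr_pwDl// mulr_ge0// ltW.
Qed.

(** The Mittag-Leffler series is entire. *)
Lemma radius_ge_Gamma (R : realType) (alpha b rho : R) : 0 < alpha -> 0 < b ->
  radius_ge rho (fun n => (Gamma (b + alpha * n%:R))^-1).
Proof.
move=> a0 b0 r r0 _; have [N0 [M [theta [th0 th1 H]]]] := gauss_dominated a0 b0 r0.
have M0 : 0 <= M.
  apply: (le_trans (normr_ge0 _)); have := H N0 0%N (leqnn _).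
  by rewrite !expr0 !mulr1; apply.
exists M => n.
have C : `|gauss N (b + alpha * n%:R) * r ^+ n| @[N --> \oo] -->
   `|(Gamma (b + alpha * n%:R))^-1 * r ^+ n|.
  apply: cvg_norm; apply: cvgM; last exact: cvg_cst.
  by apply: cvg_gauss; rewrite ltr_pwDl// mulr_ge0// ltW.
rewrite -[r ^+ n]ger0_norm ?exprn_ge0 ?(ltW r0)// -normrM.
rewrite -(cvg_lim (@norm_hausdorff _ _) C); apply: limr_le; first exact: (cvgP _ C).
exists N0 => // N /= NN; apply: le_trans (H N n NN) _.
by rewrite ler_piMr// exprn_ile1// ltW.
Qed.

Lemma psum_expr_scale (R : realType) (a : nat -> R) (c t : R) :
  psum (fun n => c ^+ n * a n) t = psum a (c * t).
Proof.
rewrite /psum /pseries; congr (limn (series _)); apply/funext => n /=.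
by rewrite exprMn; ring.
Qed.

(** The expansion [HA], used at [s = n - p], turns the series into a combination
of those of [kernelE] at [t / X ^ alpha]. *)
Lemma psum_gaussE (R : realType) (alpha beta p t : R) N (A : nat -> R) :
  let X : R := N.+1%:R in
  (forall s : R, rbinom N.+1 (beta + alpha * s) =
     \sum_(k < N.+2) A k * rbinom k (s + 1)) ->
  0 < t -> t < X `^ alpha ->
  psum (fun n => gauss N (beta - alpha * p + alpha * n%:R)) t =
  X `^ (1 - beta) * X `^ (alpha * p) *
    \sum_(k < N.+2) A k * psum (fun n => rbinom k (n%:R + 1 - p)) (X `^ (- alpha) * t).
Proof.
move=> X HA t0 tX; have X0 : 0 < X by [].
have Xa : 0 < X `^ alpha by rewrite powR_gt0.
have la1 : `|X `^ (- alpha) * t| < 1.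
  by rewrite gtr0_norm ?mulr_gt0 ?powR_gt0// powRN ltr_pdivrMl// mulr1.
rewrite -(@psum_sum R 1 _ (fun k n => rbinom k (n%:R + 1 - p)) A _
  (fun k => @radius_ge_rbinom_shift R k p)) //.
rewrite -psum_expr_scale -(@psumZ R (X `^ alpha)) //; last first.
- by rewrite gtr0_norm.
- move=> r r0 rX; have rl : r / X `^ alpha < 1 by rewrite ltr_pdivrMr// mul1r.
  have [||M HM] := @radius_ge_sum R 1 N.+2 _ A (fun k => @radius_ge_rbinom_shift R k p)
    (r / X `^ alpha) => //; first exact: divr_gt0.
  exists M => n; apply: le_trans (HM n).
  rewrite normrM ger0_norm ?exprn_ge0 ?powR_ge0// powRN exprVn expr_div_n.
  by rewrite le_eqVlt; apply/orP; left; apply/eqP; ring.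
apply: eq_psum => n.
have -> : beta - alpha * p + alpha * n%:R = beta + alpha * (n%:R - p) by ring.
rewrite /gauss -/X HA mulrA; congr (_ * _).
  rewrite -powR_mulrn ?powR_ge0// -powRrM -!powRD ?(gt_eqF X0) ?implybT//.
  by congr (_ `^ _); ring.
by apply: eq_bigr => k _; congr (_ * rbinom _ _); ring.
Qed.

(** The gap is the pointwise limit of its Gauss approximations of index [N], which
satisfy [diff_mono] on [(0, (N + 1) ^ alpha)], an interval containing [(0, L)]
for [N] large. *)
Lemma diff_mono_ML_gap (R : realType) (alpha beta q : R) n L :
  0 < alpha -> alpha < 1 -> alpha <= beta -> 0 <= q -> q < 1 ->
  diff_mono n L (fun t =>
    t `^ (- q) * psum (fun n => (Gamma (beta - alpha * q + alpha * n%:R))^-1) t -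
    psum (fun n => (Gamma (beta + alpha * n%:R))^-1) t).
Proof.
move=> a0 a1 ab q0 q1.
have b0 : 0 < beta by lra.
have bq : 0 < beta - alpha * q by have : 0 < alpha * (1 - q); [rewrite mulr_gt0//; lra|lra].
apply: (@diff_mono_lim _ _ _ (fun N t =>
    t `^ (- q) * psum (fun n => gauss N (beta - alpha * q + alpha * n%:R)) t -
    psum (fun n => gauss N (beta + alpha * n%:R)) t)).
  move=> t t0 _; apply: cvgB; last exact: cvg_psum_gauss.
  by apply: cvgM; [exact: cvg_cst|exact: cvg_psum_gauss].
pose N0 := Num.trunc (`|L| `^ alpha^-1).
exists N0 => // N /= NN; pose X : R := N.+1%:R.
have X0 : 0 < X by [].
have LX : L <= X `^ alpha.
  apply: le_trans (ler_norm _) _.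
  have : `|L| `^ alpha^-1 < N0.+1%:R.
    by have /andP[] : N0%:R <= `|L| `^ alpha^-1 < N0.+1%:R by apply: truncn_itv; exact: powR_ge0.
  move=> h; have {}h : `|L| `^ alpha^-1 < X by apply: lt_le_trans h _; rewrite ler_nat.
  move: h => /(gt0_ltr_powR a0); rewrite !nnegrE powR_ge0 (ltW X0) => /(_ isT isT).
  by rewrite -powRrM mulVf ?gt_eqF// powRr1// => /ltW.
have Xa : 0 < X `^ alpha by rewrite powR_gt0.
apply: diff_mono_le LX _.
have [A [A0 HA]] := @rbinom_affine_expansion R alpha beta N.+1 (ltW a0) (ltW a1) ab.
pose T k (x : R) := x `^ (- q) * psum (fun n => rbinom k (n%:R + 1 - q)) x -
  psum (fun n => rbinom k (n%:R + 1 - 0)) x.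
apply: (@eq_diff_mono _ _ _ (fun t =>
    X `^ (1 - beta) * \sum_(k < N.+2) A k * T k (X `^ (- alpha) * t))).
  move=> t t0 tX.
  have E := psum_gaussE 0 HA t0 tX; rewrite mulr0 subr0 powRr0 mulr1 in E.
  rewrite E (psum_gaussE q HA t0 tX) -/X.
  have P : t `^ (- q) * X `^ (alpha * q) = (X `^ (- alpha) * t) `^ (- q).
    rewrite powRM ?powR_ge0 ?(ltW t0)// mulrC -powRrM.
    by congr (_ `^ _ * _); ring.
  rewrite [_ `^ (- q) * _]mulrA [t `^ (- q) * _]mulrCA -!mulrA -mulrBr; congr (_ * _).
  rewrite /T -P mulrA.
  by rewrite mulr_sumr -sumrB; apply: eq_bigr => k _; ring.
apply: diff_monoM; first exact/diff_mono_cst/powR_ge0.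
apply: (@diff_mono_sum _ n _ _ (fun k t => A k * T k (X `^ (- alpha) * t))) => k _.
apply: diff_monoM; first exact: diff_mono_cst.
have Xna : 0 < X `^ (- alpha) by rewrite powR_gt0.
have := diff_mono_scale Xna (diff_mono_kernel q0 (ltW q1) n k).
by rewrite div1r powRN invrK.
Qed.

(** * From finite differences to derivatives *)

(** [f] has [n] successive derivatives on [(0, +oo)]; its values elsewhere are
irrelevant. *)
Fixpoint smooth_pos (R : realType) (n : nat) (f : R -> R) : Prop :=
  match n with
  | 0 => True
  | m.+1 => exists g, (forall x : R, 0 < x -> is_derive x 1 f (g x)) /\ smooth_pos m g
  end.

Section SmoothPos.
Variable R : realType.
Implicit Types f g : R -> R.

Lemma near_pos (x : R) (P : R -> Prop) : 0 < x -> (forall y, 0 < y -> P y) ->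
  \forall y \near x, P y.
Proof.
by move=> x0 HP; near=> y; apply: HP; near: y; exact: lt_nbhsr.
Unshelve. all: by end_near. Qed.

Lemma eq_smooth_pos n f g : (forall x, 0 < x -> f x = g x) ->
  smooth_pos n f -> smooth_pos n g.
Proof.
case: n => // n fg [d [Hd Hs]]; exists d; split => // x x0.
apply: near_eq_is_derive (Hd x x0); exact: near_pos.
Qed.

Lemma smooth_posW n f : smooth_pos n.+1 f -> smooth_pos n f.
Proof.
elim: n f => // n IH f [g [Hg Hs]]; exists g; split => //.
exact: IH.
Qed.

Lemma smooth_posD n f g : smooth_pos n f -> smooth_pos n g ->
  smooth_pos n (fun x => f x + g x).
Proof.
elim: n f g => // n IH f g [df [Hf Sf]] [dg [Hg Sg]].
exists (fun x => df x + dg x); split; last exact: IH.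
by move=> x x0; exact: (is_deriveD (Hf x x0) (Hg x x0)).
Qed.

Lemma smooth_posM n f g : smooth_pos n f -> smooth_pos n g ->
  smooth_pos n (fun x => f x * g x).
Proof.
elim: n f g => // n IH f g Sf Sg; have [df [Hf Sdf]] := Sf; have [dg [Hg Sdg]] := Sg.
exists (fun x => f x * dg x + g x * df x); split.
  by move=> x x0; exact: (is_deriveM (Hf x x0) (Hg x x0)).
by apply: smooth_posD; apply: IH => //; exact: smooth_posW.
Qed.

Lemma smooth_pos_cst n (c : R) : smooth_pos n (fun=> c).
Proof.
elim: n c => // n IH c; exists (fun=> 0); split => // x x0.
exact: is_derive_cst.
Qed.

Lemma smooth_pos_powR n (s : R) : smooth_pos n (fun x => x `^ s).
Proof.
elim: n s => // n IH s; exists (fun x => s * x `^ (s - 1)); split.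
  by move=> x x0; exact: is_derive1_powR.
by apply: smooth_posM; [exact: smooth_pos_cst|exact: IH].
Qed.

Lemma smooth_pos_psum n (a : nat -> R) : (forall rho, radius_ge rho a) ->
  smooth_pos n (psum a).
Proof.
elim: n a => // n IH a Ha; exists (psum (pseries_diffs a)); split.
  move=> x x0; apply: (is_derive_psum (Ha (`|x| + 1))).
  by rewrite ltrDl.
by apply: IH => rho; exact: radius_ge_diffs.
Qed.

(** The derivative is the limit of difference quotients with steps [1 / k.+1].
The scalar [c] carries the alternating sign through the iteration. *)
Lemma diff_mono_derive1 n f (c : R) : smooth_pos 1 f ->
  (forall L, diff_mono n.+1 L (fun x => c * f x)) ->
  forall L, diff_mono n L (fun x => - c * derive1 f x).
Proof.
move=> [g [Hg _]] Hf L.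
apply: (@diff_mono_lim _ _ _ (fun k x =>
    k.+1%:R * (c * f x - c * f (x + k.+1%:R^-1)))).
  move=> x x0 _; have [df _] := Hg x x0.
  have h0 : harmonic k @[k --> \oo] --> (0 : R)^'.
    move=> A HA; have H : \forall k \near \oo, harmonic k != 0 :> R -> A (harmonic k).
      exact: (@cvg_harmonic R _ HA).
    apply: filterS H => k; apply; apply: lt0r_neq0; exact: harmonic_gt0.
  have C := cvg_comp _ _ h0 df.
  rewrite derive1E.
  rewrite [X in X @ _](_ : _ = fun k : nat => - c *
    ((harmonic k)^-1 *: (f (harmonic k *: (1 : R) + x) - f x))).
    by apply: cvgM; [exact: cvg_cst|exact: C].
  apply/funext => k; rewrite /harmonic/= invrK /GRing.scale/= mulr1.
  by rewrite [k.+1%:R^-1 + x]addrC; ring.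
apply: nearW => k; apply: diff_monoM; first exact: diff_mono_cst.
have k0 : 0 < k.+1%:R^-1 :> R by rewrite invr_gt0.
by have [_ /(_ _ k0)] := Hf (L + k.+1%:R^-1); rewrite addrK.
Qed.

Lemma smooth_pos_derive1 n f : smooth_pos n.+1 f -> smooth_pos n (derive1 f).
Proof.
move=> [g [Hg Sg]]; apply: eq_smooth_pos Sg => x x0.
by have [_ <-] := Hg x x0; rewrite derive1E.
Qed.

Lemma diff_mono_derive1n n f (c x : R) : 0 < x -> smooth_pos n.+1 f ->
  (forall L, diff_mono n L (fun x => c * f x)) ->
  derivable (derive1n n f) x 1 /\ 0 <= c * (-1) ^+ n * derive1n n f x.
Proof.
move=> x0; elim: n f c => [|n IH] f c Sf Hf.
  split; first by have [g [Hg _]] := Sf; have [] := Hg x x0.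
  by rewrite derive1n0 expr0 mulr1; apply: (diff_mono_ge0 (Hf (x + 1))) => //; lra.
have S1 : smooth_pos 1 f by have [g [Hg _]] := Sf; exists g.
have := IH (derive1 f) (- c) (smooth_pos_derive1 Sf) (diff_mono_derive1 S1 Hf).
have -> : derive1n n (derive1 f) = derive1n n.+1 f.
  by rewrite /derive1n iterSr.
by rewrite exprS mulN1r mulrN mulNr.
Qed.

Lemma diff_mono_completely_monotonic f : (forall n, smooth_pos n f) ->
  (forall n L, diff_mono n L f) -> completely_monotonic f.
Proof.
move=> Sf Hf n x x0; rewrite -[(-1) ^+ n]mul1r.
apply: diff_mono_derive1n => // L.
by apply: eq_diff_mono (Hf n L) => y _ _; rewrite mul1r.
Qed.

End SmoothPos.

(** * The function D *)

Section Dfun.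
Variables (R : realType) (alpha beta : R).
Hypotheses (a0 : 0 < alpha) (b0 : 0 < beta).

Let e (n : nat) : R := (Gamma (beta + alpha * n%:R))^-1.
(** By the functional equation this is [1 / Gamma (beta + alpha (n + 1) - 1)] when
that argument of [Gamma] is positive; it is [0] when the argument is [0]. *)
Let ell (n : nat) : R := (beta + alpha * n.+1%:R - 1) * e n.+1.

Lemma radius_ge_ML_coef rho : radius_ge rho e.
Proof. exact: radius_ge_Gamma. Qed.

Lemma radius_ge_Lop_coef rho : radius_ge rho ell.
Proof.
have := radius_geS (radius_ge_affineM (beta - 1) alpha (@radius_ge_ML_coef rho)).
apply: eq_radius_ge => n.
by rewrite /ell; congr (_ * _); ring.
Qed.

Lemma DfunE (t : R) : 0 < t ->
  Dfun alpha beta (t `^ alpha^-1) = t `^ (1 - alpha^-1) * psum ell t - psum e t.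
Proof.
move=> t0; set x := t `^ alpha^-1.
have x0 : 0 < x by rewrite powR_gt0.
have xa : x `^ alpha = t by rewrite /x -powRrM mulVf ?gt_eqF// powRr1 ?ltW.
have tr : `|t| < `|t| + 1 by rewrite ltrDl.
have He := @radius_ge_ML_coef (`|t| + 1).
have D : is_derive x 1 (ML_pow alpha beta) (psum (pseries_diffs e) t * (alpha * x `^ (alpha - 1))).
  have d1 := is_derive_psum He tr; rewrite -xa in d1.
  have := @is_derive1_comp R (psum e) (@powR R ^~ alpha) x _ _ d1 (is_derive1_powR alpha x0).
  by rewrite xa.
rewrite /Dfun /Lop derive1E; have [_ ->] := D.
have M0 : ML_pow alpha beta 0 = e 0%N by rewrite ML_pow0 ?gt_eqF// /e mulr0 addr0.
have MLx : ML_pow alpha beta x = psum e t by rewrite /ML_pow xa.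
rewrite M0 MLx; congr (_ - _).
have E1 : psum e t - e 0%N = t * psum (fun n => e n.+1) t.
  by rewrite (psum_recl He tr) addrC addKr.
have E2 : psum ell t = alpha * psum (pseries_diffs e) t + (beta - 1) * psum (fun n => e n.+1) t.
  rewrite -(psumZ alpha (radius_ge_diffs He) tr) -(psumZ (beta - 1) (radius_geS He) tr).
  rewrite -(psumD (radius_geZ _ (radius_ge_diffs He)) (radius_geZ _ (radius_geS He)) tr).
  by apply: eq_psum => n; rewrite /ell /pseries_diffs; ring.
have P1 : x `^ (alpha - 1) = t / x.
  by rewrite powRB ?(gt_eqF x0) ?implybT// xa powRr1// ltW.
have P2 : t `^ (1 - alpha^-1) = t / x.
  by rewrite powRB ?(gt_eqF t0) ?implybT// powRr1// ltW.
by rewrite E1 E2 P1 P2; field; rewrite gt_eqF.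
Qed.

Hypotheses (a1 : alpha < 1) (ab : alpha <= beta) (ab1 : 1 - alpha <= beta).

Lemma diff_mono_Dfun n L : diff_mono n L (fun t => Dfun alpha beta (t `^ alpha^-1)).
Proof.
have ia : 1 < alpha^-1 by rewrite invf_gt1.
(* [m] and [q] are the integer and fractional parts of [1 / alpha - 1] *)
pose m := Num.trunc (alpha^-1 - 1); pose q := alpha^-1 - 1 - m%:R.
have /andP[mle ltm] : m%:R <= alpha^-1 - 1 < m.+1%:R by apply: truncn_itv; lra.
have q0 : 0 <= q by rewrite /q subr_ge0.
have q1 : q < 1 by rewrite /q ltrBlDl natr1.
have aq : alpha * m.+1%:R = 1 - alpha * q.
  by rewrite /q -natr1; field; rewrite gt_eqF.
have e0 i : 0 < e i by rewrite invr_gt0 Gamma_gt0// ltr_pwDl// mulr_ge0// ltW.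
have ell_tail i : ell (m + i) = (Gamma (beta - alpha * q + alpha * i%:R))^-1.
  have -> : ell (m + i) = (beta - alpha * q + alpha * i%:R) * e (m + i).+1.
    rewrite /ell; congr (_ * _); rewrite -addSn natrD mulrDr aq; ring.
  have -> : e (m + i).+1 = (Gamma (beta - alpha * q + alpha * i%:R + 1))^-1.
    rewrite /e; congr ((Gamma _)^-1); rewrite -addSn natrD mulrDr aq; ring.
  have g0 : 0 < beta - alpha * q + alpha * i%:R.
    have : 0 <= alpha * i%:R by rewrite mulr_ge0// ltW.
    have : 0 < alpha * (1 - q) by rewrite mulr_gt0// subr_gt0.
    move: ab; lra.
  by rewrite GammaD1// invfM mulVKf// gt_eqF.
apply: (@eq_diff_mono _ _ _ (fun t => \sum_(i < m) ell i * t `^ (- (alpha^-1 - i.+1%:R)) +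
  (t `^ (- q) * psum (fun n => (Gamma (beta - alpha * q + alpha * n%:R))^-1) t - psum e t))).
  move=> t t0 _; rewrite DfunE// addrA; congr (_ - _).
  have tr : `|t| < `|t| + 1 by rewrite ltrDl.
  rewrite (psum_split m (@radius_ge_Lop_coef (`|t| + 1)) tr) [RHS]mulrDr.
  rewrite [X in _ = X + _]mulr_sumr; congr (_ + _).
    apply: eq_bigr => i _; rewrite [RHS]mulrCA; congr (_ * _).
    rewrite -powR_mulrn ?ltW// -powRD ?(gt_eqF t0) ?implybT//.
    by congr (_ `^ _); rewrite -natr1; ring.
  rewrite [RHS]mulrA -powR_mulrn ?ltW// -powRD ?(gt_eqF t0) ?implybT//.
  congr (_ `^ _ * _); first by rewrite /q; ring.
  by apply: eq_psum => i; rewrite ell_tail.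
apply: diff_monoD; last exact: diff_mono_ML_gap.
apply: (@diff_mono_sum _ n _ _ (fun i t => ell i * t `^ (- (alpha^-1 - i.+1%:R)))) => i im.
have ai : alpha * 1 <= alpha * i.+1%:R by rewrite ler_pM2l// ler1n.
apply: diff_monoM.
  apply: diff_mono_cst; rewrite /ell mulr_ge0 ?(ltW (e0 _))//.
  by move: ab1; lra.
apply: diff_mono_powR.
have : i.+1%:R <= m%:R :> R by rewrite ler_nat.
by lra.
Qed.

Lemma smooth_pos_Dfun n : smooth_pos n (fun t => Dfun alpha beta (t `^ alpha^-1)).
Proof.
apply: (@eq_smooth_pos _ _ (fun t => t `^ (1 - alpha^-1) * psum ell t + -1 * psum e t)).
  by move=> t t0; rewrite DfunE// mulN1r.
apply: smooth_posD; apply: smooth_posM.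
- exact: smooth_pos_powR.
- by apply: smooth_pos_psum => rho; exact: radius_ge_Lop_coef.
- exact: smooth_pos_cst.
- by apply: smooth_pos_psum => rho; exact: radius_ge_ML_coef.
Qed.

End Dfun.

Theorem mainTheorem3 (R : realType) (alpha beta : R)
    (halpha0 : 0 < alpha) (halpha1 : alpha < 1)
    (hbeta : Num.max alpha (1 - alpha) <= beta) :
  completely_monotonic (fun x : R => Dfun alpha beta (x `^ (alpha^-1))).
Proof.
move: hbeta; rewrite ge_max => /andP[ab ab1].
have b0 : 0 < beta := lt_le_trans halpha0 ab.
apply: diff_mono_completely_monotonic => n; first exact: smooth_pos_Dfun.
by move=> L; exact: diff_mono_Dfun.
Qed.
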